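(* Let $\mathbf{f}\in\mathbf{H}(\mathrm{div})$, let $\mathbf{u}\in\mathbf{H}_0(\mathrm{curl})$ be the solution of $\mathcal{B}(\mathbf{u},\boldsymbol\psi)=(\mathbf{f},\boldsymbol\psi)_{L^2(\Omega)}$ for all $\boldsymbol\psi\in\mathbf{H}_0(\mathrm{curl})$, and let $\mathcal{K}:=-\mathcal{G}\circ\mathcal{L}$. Then $\mathbf{u}_H=\pi_H^E(\mathbf{u})\in\mathring{\mathcal{N}}(\mathcal{T}_H)$ is characterized as the unique solution in $\mathring{\mathcal{N}}(\mathcal{T}_H)$ to \[ \mathcal{B}\bigl((\mathrm{id}+\mathcal{K})\mathbf{u}_H,(\mathrm{id}+\mathcal{K}^{*})\mathbf{v}_H\bigr)=\bigl(\mathbf{f},(\mathrm{id}+\mathcal{K}^{*})\mathbf{v}_H\bigr)_{L^2(\Omega)}\quad\text{for all }\mathbf{v}_H\in\mathring{\mathcal{N}}(\mathcal{T}_H), \] where $\mathcal{K}^{*}$ is the adjoint operator to $\mathcal{K}$. Moreover, the sesquilinear form $\mathcal{B}((\mathrm{id}+\mathcal{K})\,\cdot\,,(\mathrm{id}+\mathcal{K}^{*})\,\cdot\,)$ is $\mathbf{H}(\mathrm{curl})$-elliptic on $\mathring{\mathcal{N}}(\mathcal{T}_H)$, i.e. there is $c>0$ such that $|\mathcal{B}((\mathrm{id}+\mathcal{K})\mathbf{v}_H,(\mathrm{id}+\mathcal{K}^{*})\mathbf{v}_H)|\ge c\|\mathbf{v}_H\|^2_{\mathbf{H}(\mathrm{curl})}$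 for all $\mathbf{v}_H\in\mathring{\mathcal{N}}(\mathcal{T}_H)$.
   Context: Setting: $\Omega\subset\mathbb{R}^3$ is an open, bounded, contractible domain with polyhedral Lipschitz boundary; functions are complex-valued. $\mathbf{H}(\mathrm{curl})=\mathbf{H}(\mathrm{curl},\Omega)=\{\mathbf{v}\in L^2(\Omega,\mathbb{C}^3):\mathrm{curl}\,\mathbf{v}\in L^2\}$ with norm $\|\mathbf{v}\|^2_{\mathbf{H}(\mathrm{curl})}=\|\mathrm{curl}\,\mathbf{v}\|^2_{L^2}+\|\mathbf{v}\|^2_{L^2}$; $\mathbf{H}_0(\mathrm{curl})$ is its subspace with $\mathbf{v}\times\mathbf{n}=0$ on $\partial\Omega$; $\mathbf{H}(\mathrm{div})=\{\mathbf{v}\in L^2(\Omega,\mathbb{C}^3):\mathrm{div}\,\mathbf{v}\in L^2\}$ with graph norm. Coefficients: $\mu\in L^\infty(\Omega,\mathbb{R}^{3\times3})$, $\kappa\in L^\infty(\Omega,\mathbb{C}^{3\times3})$, \[ \mathcal{B}(\mathbf{v},\boldsymbol\psi)=(\mu\,\mathrm{curl}\,\mathbf{v},\mathrm{curl}\,\boldsymbol\psi)_{L^2(\Omega)}+(\kappa\mathbf{v},\boldsymbol\psi)_{L^2(\Omega)} \] (complex $L^2$ inner products), which is continuous, and it is assumed that there is $\alpha>0$ with $|\mathcal{B}(\mathbf{v},\mathbf{v})|\ge\alpha\|\mathbf{v}\|^2_{\mathbf{H}(\mathrm{curl})}$ for all $\mathbf{v}\in\mathbf{H}_0(\mathrm{curl})$.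 $\mathbf{H}_0(\mathrm{curl})'$ is the space of bounded (antilinear, matching the second slot of $\mathcal{B}$) functionals. $\mathcal{L}:\mathbf{H}_0(\mathrm{curl})\to\mathbf{H}_0(\mathrm{curl})'$ is $\mathcal{L}(\mathbf{v})(\mathbf{w})=\mathcal{B}(\mathbf{v},\mathbf{w})$. Mesh and projection: $\mathcal{T}_H$ is a regular, shape-regular and quasi-uniform partition of $\overline\Omega$ into closed tetrahedra with mesh size $H=\max_T\mathrm{diam}(T)$; $\mathrm{N}(T)$ is the interior of the union of all elements intersecting $T$. $\mathring{\mathcal{N}}(\mathcal{T}_H)=\{\mathbf{v}\in\mathbf{H}_0(\mathrm{curl}):\mathbf{v}|_T(\mathbf{x})=\mathbf{a}_T\times\mathbf{x}+\mathbf{b}_T,\ \mathbf{a}_T,\mathbf{b}_T\in\mathbb{C}^3,\ \forall T\in\mathcal{T}_H\}$ is the lowest order Nédélec space, and $\mathring{\mathcal{RT}}(\mathcal{T}_H)$ the lowest order Raviart--Thomas space with vanishing normal trace. $\pi_H^E:\mathbf{H}_0(\mathrm{curl})\to\mathring{\mathcal{N}}(\mathcal{T}_H)$ is the Falk--Winther projection, specified here by its properties: it is linear, the identity on $\mathring{\mathcal{N}}(\mathcal{T}_H)$, satisfies for all $T\in\mathcal{T}_H$ the bounds $\|\pi_H^E\mathbf{v}\|_{L^2(T)}\le C_\pi(\|\mathbf{v}\|_{L^2(\mathrm{N}(T))}+H\|\mathrm{curl}\,\mathbf{v}\|_{L^2(\mathrm{N}(T))})$ and $\|\mathrm{curl}\,\pi_H^E\mathbf{v}\|_{L^2(T)}\le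 C_\pi\|\mathrm{curl}\,\mathbf{v}\|_{L^2(\mathrm{N}(T))}$, with $C_\pi$ depending only on the mesh regularity, and there is a linear projection $\pi_H^F:\mathbf{H}_0(\mathrm{div})\to\mathring{\mathcal{RT}}(\mathcal{T}_H)$ with $\mathrm{curl}\,\pi_H^E\mathbf{v}=\pi_H^F(\mathrm{curl}\,\mathbf{v})$. Corrector Green's Operator: $\mathbf{W}:=\ker(\pi_H^E)\subset\mathbf{H}_0(\mathrm{curl})$ (a closed subspace), and $\mathcal{G}:\mathbf{H}_0(\mathrm{curl})'\to\mathbf{W}$ is defined by $\mathcal{B}(\mathcal{G}(\mathbf{F}),\mathbf{w})=\mathbf{F}(\mathbf{w})$ for all $\mathbf{w}\in\mathbf{W}$. Thus $\mathcal{K}=-\mathcal{G}\circ\mathcal{L}:\mathbf{H}_0(\mathrm{curl})\to\mathbf{W}$. Adjoint: $\mathcal{K}^{*}$ is the adjoint of $\mathcal{K}$ with respect to $\mathcal{B}$, i.e. the operator on $\mathbf{H}_0(\mathrm{curl})$ with $\mathcal{B}(\mathcal{K}\mathbf{v},\mathbf{w})=\mathcal{B}(\mathbf{v},\mathcal{K}^{*}\mathbf{w})$ for all $\mathbf{v},\mathbf{w}\in\mathbf{H}_0(\mathrm{curl})$. *)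

(* Defs.v *)
From HB Require Import structures.
From mathcomp Require Import all_boot all_order all_algebra.
From mathcomp Require Import all_classical all_reals all_analysis.
From mathcomp Require Import complex.

Set Implicit Arguments.
Unset Strict Implicit.
Unset Printing Implicit Defensive.

Import Order.TTheory GRing.Theory Num.Theory numFieldNormedType.Exports.

Local Open Scope classical_set_scope.
Local Open Scope ring_scope.

(** * Points of R^3 and Lebesgue measure *)

(* Iterated products carry the product topology and the product (Borel)
   sigma-algebra; row vectors have no measurable structure in the library. *)
Notation pt R :=
  (measurableTypeR R * measurableTypeR R * measurableTypeR R)%type.

Definition leb3 (R : realType) : {measure set (pt R) -> \bar R} :=
  ((@lebesgue_measure R \x @lebesgue_measure R) \x @lebesgue_measure R)%E.

Definition vec (R : realType) (x : pt R) : 'cV[R]_3 :=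
  \col_i (if i == 0 then x.1.1 else if i == 1 then x.1.2 else x.2).

Definition unit_pt (R : realType) (i : 'I_3) : pt R :=
  ((i == 0)%:R, (i == 1)%:R, (i == 2)%:R).

Definition edist (R : realType) (x y : pt R) : R :=
  Num.sqrt (\sum_i (vec x i 0 - vec y i 0) ^+ 2).

Definition diam (R : realType) (A : set (pt R)) : R :=
  sup [set d | exists x y, [/\ A x, A y & d = edist x y]].

(* Indices in 'I_3 are added modulo 3. *)
Definition cross (K : pzRingType) (a b : 'cV[K]_3) : 'cV[K]_3 :=
  \col_i (a (i + 1) 0 * b (i + 2) 0 - a (i + 2) 0 * b (i + 1) 0).

(* Convex hull of the points p i, i \in S (empty if S is empty). *)
Definition conv_pts (R : realType) (I : finType) (p : I -> pt R) (S : {set I}) :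
    set (pt R) :=
  [set x | exists l : I -> R,
    [/\ forall i, 0 <= l i, forall i, i \notin S -> l i = 0,
        \sum_i l i = 1 & vec x = \sum_i l i *: vec (p i)]].

(** * The domain *)

Definition contractible (R : realType) (A : set (pt R)) : Prop :=
  exists2 x0, A x0 &
  exists h : pt R * R -> pt R,
    [/\ {within A `*` `[0, 1], continuous h},
        forall x t, A x -> 0 <= t <= 1 -> A (h (x, t)),
        forall x, A x -> h (x, 0) = x &
        forall x, A x -> h (x, 1) = x0].

(* Near each boundary point and in suitable orthonormal coordinates y = Q x,
   the set is the strict epigraph y_3 > g (y_1, y_2) of a Lipschitz g. *)
Definition lipschitz_boundary (R : realType) (A : set (pt R)) : Prop :=
  forall x, (closure A `\` interior A) x ->
  exists (Q : 'M[R]_3) (g : R -> R -> R),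
    [/\ Q *m Q^T = 1%:M,
        exists L, forall s t s' t',
          `|g s t - g s' t'| <= L * (`|s - s'| + `|t - t'|) &
        \forall z \near x,
          let y := Q *m vec z in A z <-> g (y 0 0) (y 1 0) < y 2 0].

Definition polyhedral_boundary (R : realType) (A : set (pt R)) : Prop :=
  exists (n : nat) (t : 'I_n -> 'I_3 -> pt R),
    closure A `\` interior A = \bigcup_k conv_pts (t k) [set: 'I_3]%SET.

Definition polyhedral_domain (R : realType) (Omega : set (pt R)) : Prop :=
  [/\ open Omega, bounded_set Omega, contractible Omega,
      lipschitz_boundary Omega & polyhedral_boundary Omega].

(** * Complex-valued functions and L^2 *)

Definition cint (R : realType) (A : set (pt R)) (h : pt R -> R[i]) : R[i] :=
  ((\int[@leb3 R]_(x in A) complex.Re (h x))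
   +i* (\int[@leb3 R]_(x in A) complex.Im (h x)))%C.

Notation cfield R := (pt R -> 'cV[R[i]]_3).

Definition in_L2_scalar (R : realType) (A : set (pt R)) (h : pt R -> R[i]) :
    Prop :=
  [/\ measurable_fun A (fun x => complex.Re (h x)),
      measurable_fun A (fun x => complex.Im (h x)) &
      (@leb3 R).-integrable A
        (fun x => (complex.Re (h x) ^+ 2 + complex.Im (h x) ^+ 2)%:E)].

Definition in_L2 (R : realType) (A : set (pt R)) (v : cfield R) : Prop :=
  forall i, in_L2_scalar A (fun x => v x i 0).

Definition ip (R : realType) (A : set (pt R)) (v w : cfield R) : R[i] :=
  cint A (fun x => \sum_i v x i 0 * (w x i 0)^*%C).

Definition L2norm (R : realType) (A : set (pt R)) (v : cfield R) : R :=
  Num.sqrt (complex.Re (ip A v v)).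

Definition in_Linfty (R : realType) (A : set (pt R)) (h : pt R -> R) : Prop :=
  measurable_fun A h /\
  exists M : R, {ae @leb3 R, forall x, A x -> `|h x| <= M}.

(** * Test functions *)

Definition partial (R : realType) (i : 'I_3) (f : pt R -> R) : pt R -> R :=
  fun x => 'D_(unit_pt R i) f x.

Fixpoint Ck (R : realType) (k : nat) (f : pt R -> R) : Prop :=
  continuous f /\
  if k is k'.+1 then
    forall i, (forall x, derivable f x (unit_pt R i)) /\ Ck k' (partial i f)
  else True.

(* C_c^oo(A) *)
Definition test_fun (R : realType) (A : set (pt R)) (f : pt R -> R) : Prop :=
  (forall k, Ck k f) /\
  exists K, [/\ compact K, K `<=` A & forall x, ~ K x -> f x = 0].

(* C_c^oo(A)^3 *)
Definition test_field (R : realType) (A : set (pt R))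
    (phi : 'I_3 -> pt R -> R) : Prop :=
  forall i, test_fun A (phi i).

Definition curl_test (R : realType) (phi : 'I_3 -> pt R -> R) :
    'I_3 -> pt R -> R :=
  fun i x => partial (i + 1) (phi (i + 2)) x - partial (i + 2) (phi (i + 1)) x.

Definition grad_test (R : realType) (f : pt R -> R) : 'I_3 -> pt R -> R :=
  fun i x => partial i f x.

Definition pair_test (R : realType) (A : set (pt R)) (v : cfield R)
    (phi : 'I_3 -> pt R -> R) : R[i] :=
  cint A (fun x => \sum_i v x i 0 * (phi i x)%:C%C).

(** * H(curl) and H(div) *)

(* An element of H(curl) is represented by a pair v, where v.1 is the field and
   v.2 its weak curl (unique almost everywhere).  Values outside Omega are
   irrelevant, and elements are identified by [Hcurl_eq]. *)
Notation hfield R := (cfield R * cfield R)%type.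

Definition Hcurl (R : realType) (Omega : set (pt R)) (v : hfield R) : Prop :=
  [/\ in_L2 Omega v.1, in_L2 Omega v.2 &
      forall phi, test_field Omega phi ->
        pair_test Omega v.2 phi = pair_test Omega v.1 (curl_test phi)].

(* The tangential trace is the functional
   phi |-> (curl v, phi) - (v, curl phi) on smooth fields up to the boundary,
   i.e. on restrictions to Omega of fields in C_c^oo(R^3)^3. *)
Definition H0curl (R : realType) (Omega : set (pt R)) (v : hfield R) : Prop :=
  Hcurl Omega v /\
  forall phi, test_field setT phi ->
    pair_test Omega v.2 phi - pair_test Omega v.1 (curl_test phi) = 0.

Definition Hcurl_eq (R : realType) (Omega : set (pt R)) (v w : hfield R) :
    Prop :=
  ae_eq (@leb3 R) Omega v.1 w.1 /\ ae_eq (@leb3 R) Omega v.2 w.2.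

Definition Hcurl_norm (R : realType) (Omega : set (pt R)) (v : hfield R) : R :=
  Num.sqrt (L2norm Omega v.2 ^+ 2 + L2norm Omega v.1 ^+ 2).

Definition weak_div (R : realType) (Omega : set (pt R)) (v : cfield R)
    (g : pt R -> R[i]) : Prop :=
  forall f, test_fun Omega f ->
    cint Omega (fun x => g x * (f x)%:C%C) = - pair_test Omega v (grad_test f).

Definition Hdiv (R : realType) (Omega : set (pt R)) (v : cfield R) : Prop :=
  in_L2 Omega v /\ exists g, in_L2_scalar Omega g /\ weak_div Omega v g.

(* The normal trace is the functional f |-> (v, grad f) + (div v, f) on smooth
   functions up to the boundary. *)
Definition H0div (R : realType) (Omega : set (pt R)) (v : cfield R) : Prop :=
  in_L2 Omega v /\
  exists g, [/\ in_L2_scalar Omega g, weak_div Omega v g &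
    forall f, test_fun setT f ->
      pair_test Omega v (grad_test f)
      + cint Omega (fun x => g x * (f x)%:C%C) = 0].

(** * Meshes *)

(* A mesh is a family of N tetrahedra given by their vertices. *)
Notation mesh R N := ('I_N -> 'I_4 -> pt R).

Definition elem (R : realType) (N : nat) (T : mesh R N) (k : 'I_N) :
    set (pt R) :=
  conv_pts (T k) [set: 'I_4]%SET.

(* Nondegenerate tetrahedra covering the closure of Omega; two distinct ones
   are disjoint (S = S' = set0) or meet exactly in a common vertex, edge or
   face. *)
Definition regular_partition (R : realType) (Omega : set (pt R)) (N : nat)
    (T : mesh R N) : Prop :=
  [/\ forall k, \det (\matrix_(i < 3, j < 3)
        (vec (T k (lift ord0 i)) j 0 - vec (T k ord0) j 0)) != 0,
      forall k l, k != l -> exists S S' : {set 'I_4},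
        [/\ S \proper [set: 'I_4]%SET, S' \proper [set: 'I_4]%SET,
            elem T k `&` elem T l = conv_pts (T k) S &
            elem T k `&` elem T l = conv_pts (T l) S'] &
      \bigcup_k elem T k = closure Omega].

Definition meshsize (R : realType) (N : nat) (T : mesh R N) : R :=
  \big[Num.max/0]_(k < N) diam (elem T k).

Definition shape_regular (R : realType) (N : nat) (T : mesh R N) (gamma : R) :
    Prop :=
  forall k, exists c r, [/\ 0 < r, [set x | edist c x <= r] `<=` elem T k &
    diam (elem T k) <= gamma * r].

Definition quasi_uniform (R : realType) (N : nat) (T : mesh R N) (sigma : R) :
    Prop :=
  forall k, meshsize T <= sigma * diam (elem T k).

Definition patch (R : realType) (N : nat) (T : mesh R N) (k : 'I_N) :
    set (pt R) :=
  interior (\bigcup_(l in [set l | elem T l `&` elem T k !=set0]) elem T l).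

Definition vecC (R : realType) (x : pt R) : 'cV[R[i]]_3 :=
  map_mx (fun r : R => r%:C%C) (vec x).

(* Elements are intersected with Omega since fields are meaningful only there;
   this removes only a part of the boundary of Omega, a null set. *)
Definition Nedelec (R : realType) (Omega : set (pt R)) (N : nat)
    (T : mesh R N) (v : hfield R) : Prop :=
  H0curl Omega v /\
  forall k, exists a b : 'cV[R[i]]_3,
    ae_eq (@leb3 R) (elem T k `&` Omega) v.1 (fun x => cross a (vecC x) + b).

Definition RaviartThomas (R : realType) (Omega : set (pt R)) (N : nat)
    (T : mesh R N) (v : cfield R) : Prop :=
  H0div Omega v /\
  forall k, exists (a : R[i]) (b : 'cV[R[i]]_3),
    ae_eq (@leb3 R) (elem T k `&` Omega) v (fun x => a *: vecC x + b).

(** * Operators *)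

(* Linear maps on the quotient of D by eqv, given on representatives. *)
Definition linear_op (K : pzRingType) (V : lmodType K) (D : V -> Prop)
    (eqv : V -> V -> Prop) (op : V -> V) : Prop :=
  (forall v w, D v -> D w -> eqv v w -> eqv (op v) (op w)) /\
  (forall a v w, D v -> D w -> eqv (op (a *: v + w)) (a *: op v + op w)).

Definition projection_onto (K : pzRingType) (V : lmodType K)
    (D P : V -> Prop) (eqv : V -> V -> Prop) (op : V -> V) : Prop :=
  [/\ linear_op D eqv op, forall v, D v -> P (op v) &
      forall v, P v -> eqv (op v) v].

Definition FalkWinther (R : realType) (Omega : set (pt R)) (N : nat)
    (T : mesh R N) (Cpi : R) (piE : hfield R -> hfield R) : Prop :=
  [/\ projection_onto (H0curl Omega) (Nedelec Omega T) (Hcurl_eq Omega) piE,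
      forall v k, H0curl Omega v ->
        L2norm (elem T k `&` Omega) (piE v).1 <=
        Cpi * (L2norm (patch T k `&` Omega) v.1
               + meshsize T * L2norm (patch T k `&` Omega) v.2),
      forall v k, H0curl Omega v ->
        L2norm (elem T k `&` Omega) (piE v).2 <=
        Cpi * L2norm (patch T k `&` Omega) v.2 &
      exists piF : cfield R -> cfield R,
        projection_onto (H0div Omega) (RaviartThomas Omega T)
          (ae_eq (@leb3 R) Omega) piF /\
        forall v, H0curl Omega v ->
          ae_eq (@leb3 R) Omega (piE v).2 (piF v.2)].

Definition Bform (R : realType) (Omega : set (pt R))
    (mu : pt R -> 'M[R]_3) (kappa : pt R -> 'M[R[i]]_3) (v psi : hfield R) :
    R[i] :=
  ip Omega (fun x => map_mx (fun r : R => r%:C%C) (mu x) *m v.2 x) psi.2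
  + ip Omega (fun x => kappa x *m v.1 x) psi.1.

Definition coefficients (R : realType) (Omega : set (pt R))
    (mu : pt R -> 'M[R]_3) (kappa : pt R -> 'M[R[i]]_3) : Prop :=
  forall i j,
    [/\ in_Linfty Omega (fun x => mu x i j),
        in_Linfty Omega (fun x => complex.Re (kappa x i j)) &
        in_Linfty Omega (fun x => complex.Im (kappa x i j))].

(* Bounded antilinear functionals on H_0(curl). *)
Definition H0curl_dual (R : realType) (Omega : set (pt R))
    (F : hfield R -> R[i]) : Prop :=
  (forall a v w, H0curl Omega v -> H0curl Omega w ->
     F (a *: v + w) = a^*%C * F v + F w) /\
  exists M : R, forall v, H0curl Omega v ->
    `|F v| <= (M * Hcurl_norm Omega v)%:C%C.

Definition Lop (R : realType) (Omega : set (pt R))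
    (mu : pt R -> 'M[R]_3) (kappa : pt R -> 'M[R[i]]_3) (v : hfield R) :
    hfield R -> R[i] :=
  fun w => Bform Omega mu kappa v w.

Definition Wker (R : realType) (Omega : set (pt R))
    (piE : hfield R -> hfield R) (w : hfield R) : Prop :=
  H0curl Omega w /\ Hcurl_eq Omega (piE w) 0.

Definition corrector_green (R : realType) (Omega : set (pt R))
    (mu : pt R -> 'M[R]_3) (kappa : pt R -> 'M[R[i]]_3)
    (piE : hfield R -> hfield R) (G : (hfield R -> R[i]) -> hfield R) : Prop :=
  forall F, H0curl_dual Omega F ->
    Wker Omega piE (G F) /\
    forall w, Wker Omega piE w -> Bform Omega mu kappa (G F) w = F w.

Definition Kop (R : realType) (Omega : set (pt R))
    (mu : pt R -> 'M[R]_3) (kappa : pt R -> 'M[R[i]]_3)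
    (G : (hfield R -> R[i]) -> hfield R) (v : hfield R) : hfield R :=
  - G (Lop Omega mu kappa v).

Definition B_adjoint (R : realType) (Omega : set (pt R))
    (mu : pt R -> 'M[R]_3) (kappa : pt R -> 'M[R[i]]_3)
    (K Kstar : hfield R -> hfield R) : Prop :=
  (forall w, H0curl Omega w -> H0curl Omega (Kstar w)) /\
  forall v w, H0curl Omega v -> H0curl Omega w ->
    Bform Omega mu kappa (K v) w = Bform Omega mu kappa v (Kstar w).

Definition galerkin (R : realType) (Omega : set (pt R)) (N : nat)
    (T : mesh R N) (mu : pt R -> 'M[R]_3) (kappa : pt R -> 'M[R[i]]_3)
    (K Kstar : hfield R -> hfield R) (f : cfield R) (uH : hfield R) : Prop :=
  forall vH, Nedelec Omega T vH ->
    Bform Omega mu kappa (uH + K uH) (vH + Kstar vH)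
    = ip Omega f (vH + Kstar vH).1.

(* Main.v *)
Require Import Defs.
From HB Require Import structures.
From mathcomp Require Import all_boot all_order all_algebra.
From mathcomp Require Import all_classical all_reals all_analysis.
From mathcomp Require Import measurable_realfun complex ring lra.

(* Put W = ker pi and P = - K, so that P v lies in W and B (v - P v) w = 0 for
   w in W; by coercivity P is the identity on W.  Moving K^* to the left,
     B ((1 - P) v) ((1 - P^* ) w) = B ((1 - P)^2 v) w = B ((1 - P) v) w
                                  = B v ((1 - P^* ) w).
   As u - pi u lies in W, (1 - P) (pi u) = (1 - P) u, so pi u solves the discrete
   problem.  For v in the Nedelec space, B ((1 - P) v) v = B x x with
   x = (1 - P) v, by orthogonality to P v in W.  Since v = pi v = pi x and pi is
   bounded, coercivity gives |B x x| >= alpha |x|^2 >= c |v|^2, and ellipticity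
   gives uniqueness.  All identities hold only up to null fields, on which B
   vanishes because it is bounded. *)

Set Implicit Arguments.
Unset Strict Implicit.
Unset Printing Implicit Defensive.

Import Order.TTheory GRing.Theory Num.Theory numFieldNormedType.Exports.

Local Open Scope classical_set_scope.
Local Open Scope ring_scope.

(** * Borel sets of R^3 *)

(** [pt R] carries the product sigma-algebra, so its measurable sets are built from boxes. An open
    set is the union of the boxes with rational centre and rational radius that it contains, and
    these are countably many. *)
Lemma open_measurable_pt (R : realType) (U : set (pt R)) :
  open U -> measurable U.
Proof.
move=> oU.
pose box (q : rat * rat * rat * rat) : set (pt R) :=
  [set a | `|ratr q.1.1.1 - a| < ratr q.2] `*`
  [set b | `|ratr q.1.1.2 - b| < ratr q.2] `*`
  [set c | `|ratr q.1.2 - c| < ratr q.2].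
have mside (p r : rat) :
    measurable [set a : measurableTypeR R | `|ratr p - a| < ratr r].
  have -> : [set a : R | `|ratr p - a| < ratr r] =
      `](ratr p - ratr r), (ratr p + ratr r)[%classic.
    by apply/seteqP; split=> a /=; rewrite in_itv/= distrC ltr_distl.
  exact: measurable_itv.
have mbox q : measurable (box q) by do 2 apply: measurableX => //; exact: mside.
have -> : U = \bigcup_q (if `[< box q `<=` U >] then box q else set0).
  apply/seteqP; split=> [[[x1 x2] x3] Ux|x [q _]]; last first.
    by case: asboolP => // qU /qU.
  have /nbhs_ballP[e /= e0 eU] : nbhs (x1, x2, x3) U by exact: open_nbhs_nbhs.
  (* Half of [e], because two points of one box are compared through its rational centre, at
     distance less than [r] from each. *)
  have [r /[!in_itv]/= /andP[r0 re]] : exists r, ratr r \in `]0, e / 2[.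
    by apply: rat_in_itvoo; rewrite divr_gt0.
  have near_rat (x : measurableTypeR R) : exists q : rat, `|ratr q - x| < ratr r.
    have [q /[!in_itv]/= qx] : exists q, ratr q \in `](x - ratr r), (x + ratr r)[.
      by apply: rat_in_itvoo; rewrite ltrD2l (lt_trans _ r0)// oppr_lt0.
    by exists q; rewrite ltr_distl.
  have [q1 h1] := near_rat x1; have [q2 h2] := near_rat x2.
  have [q3 h3] := near_rat x3.
  exists (q1, q2, q3, r) => //; rewrite asboolT// => -[[y1 y2] y3].
  case=> -[/= k1 k2] k3; apply: eU.
  have close (x y : R) q : `|ratr q - x| < ratr r -> `|ratr q - y| < ratr r ->
      ball x e y.
    move=> h k; rewrite -ball_normE /= (splitr e).
    rewrite (le_lt_trans (ler_distD (ratr q) _ _))// ltrD//; last first.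
      exact: lt_trans re.
    by rewrite distrC (lt_trans h).
  by split; [split|]; [exact: close h1 k1|exact: close h2 k2|exact: close h3 k3].
apply: countable_bigcupT_measurable => [|q]; first exact: countableP.
by case: ifP.
Qed.

Lemma closed_measurable_pt (R : realType) (A : set (pt R)) :
  closed A -> measurable A.
Proof. by move=> /closed_openC/open_measurable_pt/measurableC; rewrite setCK. Qed.

Lemma continuous_measurable_pt (R : realType) (f : pt R -> R) (A : set (pt R)) :
  measurable A -> continuous f -> measurable_fun A f.
Proof.
move=> mA cf; apply: (measurable_funS measurableT) => //.
apply: (measurability _ (RGenOpens.measurableE R)) => _ [_ [a [b ->] <-]].
rewrite setTI; apply: open_measurable_pt; apply: open_comp => //.
Qed.

Lemma continuous_pair (T U V : topologicalType) (f : T -> U) (g : T -> V) :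
  continuous f -> continuous g -> continuous (fun x => (f x, g x)).
Proof. by move=> cf cg x; apply: cvg_pair; [exact: cf|exact: cg]. Qed.

(** A closed tetrahedron is the continuous image, under barycentric coordinates, of the standard
    simplex of R^4. It is therefore compact, hence closed, hence Borel. *)
Lemma conv_pts_measurable (R : realType) (p : 'I_4 -> pt R) :
  measurable (conv_pts p [set: 'I_4]%SET).
Proof.
apply: closed_measurable_pt; apply: compact_closed; first exact: norm_hausdorff.
pose comb (c : 'I_4 -> R) (l : 'rV[R]_4) : R := \sum_i l 0 i * c i.
have ccomb c : continuous (comb c).
  move=> l; apply: cvg_big => [| |i _]; [exact: add_continuous|exact: nbhs_filter|].
  by apply: cvgMr_tmp; [exact: nbhs_filter|exact: (@coord_continuous R 1 4)].
pose f l : pt R :=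
  (comb (fun i => (p i).1.1) l, comb (fun i => (p i).1.2) l,
   comb (fun i => (p i).2) l).
have cf : continuous f.
  by do 2 apply: continuous_pair => //; exact: ccomb.
pose S := [set l : 'rV[R]_4 | (forall i, 0 <= l 0 i) /\ comb (fun=> 1) l = 1].
have -> : conv_pts p [set: 'I_4]%SET = f @` S.
  have vecE (l : 'I_4 -> R) :
      \sum_i l i *: vec (p i) = vec (f (\row_i l i)).
    apply/colP => j; rewrite summxE mxE /f /comb /=.
    case: ifP => j0; [|case: ifP => j1];
      by apply: eq_bigr => i _; rewrite !mxE j0 ?j1.
  have rowK (l : 'rV[R]_4) : \row_i l 0 i = l.
    by apply/rowP => i; rewrite mxE.
  apply/seteqP; split=> [x [l [l0 _ l1 xl]]|_ [l [l0 l1] <-]].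
    exists (\row_i l i).
      split=> [i|]; first by rewrite mxE.
      by rewrite -[RHS]l1 /comb; apply: eq_bigr => i _; rewrite mxE mulr1.
    move: xl; rewrite vecE; case: (f _) => [[y1 y2] y3]; case: x => [[x1 x2] x3].
    by move/colP => xy; congr (_, _, _);
      [have := xy 0|have := xy 1|have := xy (1 + 1)]; rewrite !mxE.
  exists (fun i => l 0 i); split=> //.
  - by move=> i; rewrite inE.
  - by rewrite -[RHS]l1 /comb; apply: eq_bigr => i _; rewrite mulr1.
  - by rewrite (vecE (fun i => l 0 i)) rowK.
apply: continuous_compact; first exact: continuous_subspaceT.
(* Coordinates in the simplex are nonnegative with sum 1, so the maximum norm is at most 1;
   closedness is that of the defining conditions. *)
apply: bounded_closed_compact.
  exists 1; split=> // M M1 l [l0 l1]; apply: le_trans (ltW M1).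
  rewrite [leLHS]/Num.norm/= mx_normrE; apply: bigmax_le => // -[i j] _ /=.
  rewrite ord1 ger0_norm// -l1 /comb (bigD1 j)//= mulr1 lerDl.
  by apply: sumr_ge0 => k _; rewrite mulr1.
have -> : S = \bigcap_(i in [set: 'I_4]) [set l : 'rV[R]_4 | 0 <= l 0 i] `&`
    comb (fun=> 1) @^-1` [set 1].
  by apply/seteqP; split=> l [l0 l1]; split=> // i *; exact: l0.
apply: closedI.
  apply: closed_bigI => i _.
  apply: (@closed_comp _ _ (fun l : 'rV[R]_4 => l 0 i) [set x | 0 <= x]).
    by move=> l _; exact: coord_continuous.
  exact: closed_ge.
apply: closed_comp; first by move=> l _; exact: ccomb.
exact: closed_eq.
Qed.

Lemma bounded_pt_box (R : realType) (A : set (pt R)) : bounded_set A ->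
  exists M : R, A `<=` `[- M, M] `*` `[- M, M] `*` `[- M, M].
Proof.
(* Boundedness provides a bound for every number strictly above [M], hence [M + 1]. The product norm
   is a maximum, so its balls are boxes. *)
case=> M [_ bM]; exists (M + 1) => -[[x y] z] /(bM (M + 1)).
rewrite ltrDl ltr01 => /(_ isT); rewrite /= !prod_normE /= !ge_max /=.
by rewrite !in_itv/= -!ler_norml => /andP[/andP[]].
Qed.

Lemma bounded_leb3_lty (R : realType) (A : set (pt R)) :
  measurable A -> bounded_set A -> (@leb3 R A < +oo)%E.
Proof.
move=> mA /bounded_pt_box[M AM].
pose I : set (measurableTypeR R) := `[- M, M]%classic.
have mI : measurable I by exact: measurable_itv.
have le_box : (@leb3 R A <= @leb3 R (I `*` I `*` I))%E.
  by apply: le_measure; rewrite ?inE//; do 2 apply: measurableX => //.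
apply: le_lt_trans le_box _.
have -> : (@leb3 R (I `*` I `*` I) =
    (lebesgue_measure \x lebesgue_measure) (I `*` I) * lebesgue_measure I)%E.
  by apply: product_measure1E => //; exact: measurableX.
rewrite product_measure1E//= /I lebesgue_measure_itv/=.
by case: ifP => _; rewrite ?mule0// -?EFinD -!EFinM ltry.
Qed.

(** [A] may fail to be closed, so compactness is taken from a closed box around it. *)
Lemma continuous_bounded_pt (R : realType) (A : set (pt R)) (g : pt R -> R) :
  bounded_set A -> continuous g -> exists C, forall x, A x -> `|g x| <= C.
Proof.
move=> /bounded_pt_box[M AM] cg.
have cI : compact (`[- M, M]%classic : set (measurableTypeR R)).
  exact: segment_compact.
have cB : compact (g @` (`[- M, M] `*` `[- M, M] `*` `[- M, M])).
  apply: continuous_compact; first exact: continuous_subspaceT.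
  by do 2 apply: compact_setX => //.
have [C [_ bC]] := compact_bounded cB.
exists (C + 1) => x Ax; apply: bC; first by rewrite ltrDl.
by exists x => //; exact: AM.
Qed.

(** * Square-integrable fields *)

Section square_integrable.
Context d (T : measurableType d) (R : realType) (mu : {measure set T -> \bar R}).
Variables (A : set T) (mA : measurable A).
Implicit Types (a b c : T -> R) (k : R).

Definition sqint a :=
  measurable_fun A a /\ mu.-integrable A (fun x => (a x ^+ 2)%:E).

Lemma integrable_EFinD a b : mu.-integrable A (fun x => (a x)%:E) ->
  mu.-integrable A (fun x => (b x)%:E) ->
  mu.-integrable A (fun x => (a x + b x)%:E).
Proof. by move=> ia ib; exact: (integrableD mA ia ib). Qed.

Lemma integrable_EFinZl k a : mu.-integrable A (fun x => (a x)%:E) ->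
  mu.-integrable A (fun x => (k * a x)%:E).
Proof. by move=> ia; exact: (integrableZl mA k ia). Qed.

(** The product is dominated by [a ^+ 2 + b ^+ 2], since the squares of [a + b] and [a - b] are
    nonnegative. *)
Lemma sqintM a b : sqint a -> sqint b ->
  mu.-integrable A (fun x => (a x * b x)%:E).
Proof.
move=> [ma ia] [mb ib].
apply: (@le_integrable _ _ _ _ _ mA _ (fun x => (a x ^+ 2 + b x ^+ 2)%:E)).
- by apply/measurable_EFinP; exact: measurable_funM.
- move=> x _ /=; rewrite lee_fin [leRHS]ger0_norm ?addr_ge0 ?sqr_ge0//.
  have := sqr_ge0 (a x - b x); have := sqr_ge0 (a x + b x).
  rewrite ler_norml sqrrB sqrrD => h1 h2.
  have a0 := sqr_ge0 (a x); have b0 := sqr_ge0 (b x).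
  by apply/andP; split; lra.
- exact: integrable_EFinD.
Qed.

Lemma sqint_lin k a b : sqint a -> sqint b -> sqint (fun x => k * a x + b x).
Proof.
move=> sa sb; have iab := sqintM sa sb; have [ma ia] := sa; have [mb ib] := sb.
split; first by apply: measurable_funD => //; exact: measurable_funM.
rewrite (_ : (fun x => _) =
    (fun x => (k ^+ 2 * a x ^+ 2 + (2 * k * (a x * b x) + b x ^+ 2))%:E)).
  by do 2 ?[apply: integrable_EFinD => //]; exact: integrable_EFinZl.
by apply/funext => x; congr EFin; ring.
Qed.

Lemma sqint0 : sqint (fun=> 0).
Proof.
by split; [exact: measurable_cst|rewrite expr0n /=; exact: integrable0].
Qed.

Definition L2nrm a := Num.sqrt (\int[mu]_(x in A) (a x ^+ 2)).

Lemma Cauchy_Schwarz a b : sqint a -> sqint b ->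
  `|\int[mu]_(x in A) (a x * b x)| <= L2nrm a * L2nrm b.
Proof.
move=> sa sb; have iab := sqintM sa sb; have [ma ia] := sa; have [mb ib] := sb.
rewrite /L2nrm; set p := (X in Num.sqrt X * _); set q := (X in _ * Num.sqrt X).
set c := (X in `|X|).
have p0 : 0 <= p by apply: Rintegral_ge0 => x _; exact: sqr_ge0.
have q0 : 0 <= q by apply: Rintegral_ge0 => x _; exact: sqr_ge0.
(* The discriminant argument: this quadratic in [s] is the integral of [(a - s * b) ^+ 2]. *)
have quad s : 0 <= p - 2 * s * c + s ^+ 2 * q.
  suff -> : p - 2 * s * c + s ^+ 2 * q = \int[mu]_(x in A) ((a x - s * b x) ^+ 2).
    by apply: Rintegral_ge0 => x _; exact: sqr_ge0.
  have i1 := integrable_EFinZl (- (2 * s)) iab.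
  have i2 := integrable_EFinZl (s ^+ 2) ib.
  have -> : (fun x => (a x - s * b x) ^+ 2) = (fun x =>
      (a x ^+ 2 + - (2 * s) * (a x * b x)) + s ^+ 2 * b x ^+ 2).
    by apply/funext => x; ring.
  rewrite RintegralD//; last exact: integrable_EFinD.
  by rewrite RintegralD// !RintegralZl// mulNr.
rewrite -sqrtrM// -sqrtr_sqr ler_wsqrtr//.
have [q00|qN0] := eqVneq q 0; last first.
  (* [c / q] is the minimizer of the quadratic. *)
  have := quad (c / q); have qgt0 : 0 < q by rewrite lt_def qN0.
  rewrite -(@pmulr_rge0 _ q)// => h.
  rewrite -subr_ge0 (le_trans h)// le_eqVlt; apply/orP; left; apply/eqP.
  by field.
have [c0|cN0] := eqVneq c 0; first by rewrite c0 expr0n mulr_ge0.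
(* For [q = 0] the quadratic is affine in [s]; if [c] were nonzero, this [s] would give it the value
   - 1. *)
have := quad ((p + 1) / (2 * c)); rewrite q00 mulr0 addr0.
have -> : p - 2 * ((p + 1) / (2 * c)) * c = - 1 by field.
by rewrite lerNr oppr0 ler10.
Qed.

Lemma ae_le_integrable a b : measurable_fun A a ->
  mu.-integrable A (fun x => (b x)%:E) -> (forall x, A x -> 0 <= b x) ->
  {ae mu, forall x, A x -> `|a x| <= b x} -> mu.-integrable A (fun x => (a x)%:E).
Proof.
move=> ma /integrableP[mb ib] b0 ab; apply/integrableP; split.
  exact/measurable_EFinP.
apply: le_lt_trans ib; apply: ae_ge0_le_integral => //.
- by apply: measurableT_comp => //; exact/measurable_EFinP.
- exact: measurableT_comp.
- by apply: filterS ab => x /[apply] /= h; rewrite lee_fin (le_trans h)// ler_norm.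
Qed.

(** The coefficients are bounded only almost everywhere, so the integrands are compared almost
    everywhere. *)
Lemma sqint_bddM c a (M : R) : measurable_fun A c ->
  {ae mu, forall x, A x -> `|c x| <= M} -> sqint a ->
  sqint (fun x => c x * a x) /\
  \int[mu]_(x in A) ((c x * a x) ^+ 2) <= M ^+ 2 * \int[mu]_(x in A) (a x ^+ 2).
Proof.
move=> mc cM [ma ia]; have mca : measurable_fun A (fun x => c x * a x).
  exact: measurable_funM.
have bnd : {ae mu, forall x, A x -> (c x * a x) ^+ 2 <= M ^+ 2 * a x ^+ 2}.
  apply: filterS cM => x /[apply] h; rewrite exprMn ler_wpM2r ?sqr_ge0//.
  by rewrite -(real_normK (num_real (c x))) lerXn2r ?nnegrE// (le_trans _ h).
have iM := integrable_EFinZl (M ^+ 2) ia.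
have ica : mu.-integrable A (fun x => ((c x * a x) ^+ 2)%:E).
  apply: (ae_le_integrable _ iM).
  - exact: measurable_funX.
  - by move=> x _; rewrite mulr_ge0 ?sqr_ge0.
  - by apply: filterS bnd => x /[apply] h; rewrite ger0_norm ?sqr_ge0.
split=> //; rewrite -RintegralZl//; apply: fine_le.
- exact: integrable_fin_num.
- exact: integrable_fin_num.
apply: ae_ge0_le_integral => //.
- by move=> x _; rewrite lee_fin sqr_ge0.
- by case/integrableP : ica.
- by move=> x _; rewrite lee_fin mulr_ge0 ?sqr_ge0.
- by case/integrableP : iM.
Qed.

End square_integrable.

(** * Complex-valued scalar functions in L^2 *)

Section complex_L2.
Variable R : realType.
Notation mu := (@leb3 R).
Variables (A : set (pt R)) (mA : measurable A).
Implicit Types (h k f g : pt R -> R[i]) (c : R[i]).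

Lemma normc_leD (z : R[i]) : `|z| <= (`|complex.Re z| + `|complex.Im z|)%:C%C.
Proof.
rewrite normc_def lecR -[leRHS]ger0_norm ?addr_ge0// -sqrtr_sqr ler_wsqrtr//.
rewrite sqrrD !real_normK ?num_real// lerD2r lerDl.
by rewrite mulrn_wge0// mulr_ge0.
Qed.

Lemma in_L2_scalarP h : in_L2_scalar A h <->
  sqint mu A (fun x => complex.Re (h x)) /\ sqint mu A (fun x => complex.Im (h x)).
Proof.
split=> [[mr mi ih]|[[mr ir] [mi ii]]]; last first.
  by split=> //; exact: integrable_EFinD.
by split; split=> //; apply: (le_integrable mA _ _ ih) => [|x _];
  rewrite ?lee_fin ?ger0_norm ?addr_ge0 ?sqr_ge0 ?lerDl ?lerDr ?sqr_ge0//;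
  apply/measurable_EFinP; exact: measurable_funX.
Qed.

Definition L2snorm h : R :=
  Num.sqrt (\int[mu]_(x in A) (complex.Re (h x) ^+ 2 + complex.Im (h x) ^+ 2)).

Lemma L2snorm_ge_Re h : in_L2_scalar A h ->
  L2nrm mu A (fun x => complex.Re (h x)) <= L2snorm h.
Proof.
move=> L2h; have [[_ ir] _] := (in_L2_scalarP h).1 L2h; case: L2h => _ _ ih.
by apply/ler_wsqrtr/le_Rintegral => // x _; rewrite lerDl sqr_ge0.
Qed.

Lemma L2snorm_ge_Im h : in_L2_scalar A h ->
  L2nrm mu A (fun x => complex.Im (h x)) <= L2snorm h.
Proof.
move=> L2h; have [_ [_ ii]] := (in_L2_scalarP h).1 L2h; case: L2h => _ _ ih.
by apply/ler_wsqrtr/le_Rintegral => // x _; rewrite lerDr sqr_ge0.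
Qed.

(** The guard under which [cint] is linear: an infinite real integral is turned into 0 by [fine]. *)
Definition cintegrable f :=
  mu.-integrable A (fun x => (complex.Re (f x))%:E) /\
  mu.-integrable A (fun x => (complex.Im (f x))%:E).

Lemma cint_lin c f g : cintegrable f -> cintegrable g ->
  cintegrable (fun x => c * f x + g x) /\
  cint A (fun x => c * f x + g x) = c * cint A f + cint A g.
Proof.
case: c => c1 c2 [fr fi] [gr gi].
have reE : (fun x => complex.Re ((c1 +i* c2)%C * f x + g x)) =
    fun x => (c1 * complex.Re (f x) + - c2 * complex.Im (f x)) + complex.Re (g x).
  by apply/funext => x; case: (f x) (g x) => [a b] [a' b'] /=; rewrite mulNr.
have imE : (fun x => complex.Im ((c1 +i* c2)%C * f x + g x)) =
    fun x => (c1 * complex.Im (f x) + c2 * complex.Re (f x)) + complex.Im (g x).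
  apply/funext => x; case: (f x) (g x) => [a b] [a' b'] //.
have i1 := integrable_EFinZl mA c1 fr.
have i2 := integrable_EFinZl mA (- c2) fi.
have i3 := integrable_EFinZl mA c1 fi.
have i4 := integrable_EFinZl mA c2 fr.
have i12 := integrable_EFinD mA i1 i2.
have i34 := integrable_EFinD mA i3 i4.
split; first split.
- have -> : (fun x => (complex.Re ((c1 +i* c2)%C * f x + g x))%:E) =
    EFin \o (fun x => complex.Re ((c1 +i* c2)%C * f x + g x)) by [].
  by rewrite reE; exact: integrable_EFinD.
- have -> : (fun x => (complex.Im ((c1 +i* c2)%C * f x + g x))%:E) =
    EFin \o (fun x => complex.Im ((c1 +i* c2)%C * f x + g x)) by [].
  by rewrite imE; exact: integrable_EFinD.
rewrite /cint reE imE !RintegralD// !RintegralZl//.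
by apply/eqP; rewrite eq_complex /= mulNr !eqxx.
Qed.

Lemma cint0 : cintegrable (fun=> 0) /\ cint A (fun=> 0) = 0.
Proof.
split; first by split; exact: integrable0.
by rewrite /cint /Rintegral !integral0.
Qed.

Lemma cint_sum (I : Type) (r : seq I) (F : I -> pt R -> R[i]) :
  (forall i, cintegrable (F i)) ->
  cintegrable (fun x => \sum_(i <- r) F i x) /\
  cint A (fun x => \sum_(i <- r) F i x) = \sum_(i <- r) cint A (F i).
Proof.
move=> iF; elim: r => [|i r [ir IH]].
  have -> : (fun x => \sum_(i <- [::]) F i x) = fun=> 0.
    by apply/funext => x; rewrite big_nil.
  by rewrite big_nil; exact: cint0.
have -> : (fun x => \sum_(j <- i :: r) F j x) =
    fun x => 1 * F i x + \sum_(j <- r) F j x.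
  by apply/funext => x; rewrite big_cons mul1r.
by have [] := cint_lin 1 (iF i) ir; rewrite big_cons mul1r IH.
Qed.

(** The real and imaginary parts of the product consist of four real products, each bounded by
    Cauchy-Schwarz; this gives the factor 4. *)
Lemma L2s_mulJ h k : in_L2_scalar A h -> in_L2_scalar A k ->
  cintegrable (fun x => h x * (k x)^*%C) /\
  `|cint A (fun x => h x * (k x)^*%C)| <= (4 * L2snorm h * L2snorm k)%:C%C.
Proof.
move=> L2h L2k; have [hr hi] := (in_L2_scalarP h).1 L2h.
have [kr ki] := (in_L2_scalarP k).1 L2k.
have reE : (fun x => complex.Re (h x * (k x)^*%C)) = (fun x =>
    complex.Re (h x) * complex.Re (k x) + complex.Im (h x) * complex.Im (k x)).
  by apply/funext => x; case: (h x) (k x) => [a b] [a' b'] /=; ring.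
have imE : (fun x => complex.Im (h x * (k x)^*%C)) = (fun x =>
    complex.Im (h x) * complex.Re (k x) +
    -1 * (complex.Re (h x) * complex.Im (k x))).
  by apply/funext => x; case: (h x) (k x) => [a b] [a' b'] /=; ring.
have i1 := sqintM mA hr kr; have i2 := sqintM mA hi ki.
have i3 := sqintM mA hi kr; have i4 := sqintM mA hr ki.
have i5 := integrable_EFinZl mA (-1) i4.
split; first split.
- have -> : (fun x => (complex.Re (h x * (k x)^*%C))%:E) =
    EFin \o (fun x => complex.Re (h x * (k x)^*%C)) by [].
  by rewrite reE; exact: integrable_EFinD.
- have -> : (fun x => (complex.Im (h x * (k x)^*%C))%:E) =
    EFin \o (fun x => complex.Im (h x * (k x)^*%C)) by [].
  by rewrite imE; exact: integrable_EFinD.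
apply: le_trans (normc_leD _) _; rewrite lecR /cint reE imE /=.
rewrite !RintegralD// RintegralZl// mulN1r.
have CS a b : sqint mu A a -> sqint mu A b -> L2nrm mu A a <= L2snorm h ->
    L2nrm mu A b <= L2snorm k ->
    `|\int[mu]_(x in A) (a x * b x)| <= L2snorm h * L2snorm k.
  move=> sa sb ha kb; apply: le_trans (Cauchy_Schwarz mA sa sb) _.
  by rewrite ler_pM ?sqrtr_ge0.
have n1 := CS _ _ hr kr (L2snorm_ge_Re L2h) (L2snorm_ge_Re L2k).
have n2 := CS _ _ hi ki (L2snorm_ge_Im L2h) (L2snorm_ge_Im L2k).
have n3 := CS _ _ hi kr (L2snorm_ge_Im L2h) (L2snorm_ge_Re L2k).
have n4 := CS _ _ hr ki (L2snorm_ge_Re L2h) (L2snorm_ge_Im L2k).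
apply: le_trans (lerD (ler_normD _ _) (ler_normB _ _)) _.
by rewrite -mulrA; lra.
Qed.

Lemma L2s_lin c h k : in_L2_scalar A h -> in_L2_scalar A k ->
  in_L2_scalar A (fun x => c * h x + k x).
Proof.
case: c => c1 c2 /in_L2_scalarP[hr hi] /in_L2_scalarP[kr ki]; apply/in_L2_scalarP.
have reE : (fun x => complex.Re ((c1 +i* c2)%C * h x + k x)) =
    fun x => c1 * complex.Re (h x) + (- c2 * complex.Im (h x) + complex.Re (k x)).
  by apply/funext => x; case: (h x) (k x) => [a b] [a' b'] /=; ring.
have imE : (fun x => complex.Im ((c1 +i* c2)%C * h x + k x)) =
    fun x => c1 * complex.Im (h x) + (c2 * complex.Re (h x) + complex.Im (k x)).
  by apply/funext => x; case: (h x) (k x) => [a b] [a' b'] /=; ring.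
by rewrite reE imE; split; do 2 apply: sqint_lin => //.
Qed.

Lemma L2s0 : in_L2_scalar A (fun=> 0).
Proof. by apply/in_L2_scalarP; split; exact: sqint0. Qed.

Lemma L2s_sum (I : Type) (r : seq I) (F : I -> pt R -> R[i]) :
  (forall i, in_L2_scalar A (F i)) ->
  in_L2_scalar A (fun x => \sum_(i <- r) F i x).
Proof.
move=> LF; elim: r => [|i r IH].
  by under eq_fun do rewrite big_nil; exact: L2s0.
have -> : (fun x => \sum_(j <- i :: r) F j x) =
    fun x => 1 * F i x + \sum_(j <- r) F j x.
  by apply/funext => x; rewrite big_cons mul1r.
exact: L2s_lin.
Qed.

Lemma L2s_Linfty (w : pt R -> R[i]) :
  in_Linfty A (fun x => complex.Re (w x)) ->
  in_Linfty A (fun x => complex.Im (w x)) ->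
  exists2 C, 0 <= C & forall h, in_L2_scalar A h ->
    in_L2_scalar A (fun x => w x * h x) /\
    L2snorm (fun x => w x * h x) <= C * L2snorm h.
Proof.
move=> [mr [M1 bM1]] [mi [M2 bM2]].
exists (Num.sqrt (M1 ^+ 2 + M2 ^+ 2)); first exact: sqrtr_ge0.
move=> h /in_L2_scalarP[hr hi].
have [s1 b1] := sqint_bddM mA mr bM1 hr; have [s2 b2] := sqint_bddM mA mr bM1 hi.
have [s3 b3] := sqint_bddM mA mi bM2 hr; have [s4 b4] := sqint_bddM mA mi bM2 hi.
have reE : (fun x => complex.Re (w x * h x)) = fun x =>
    -1 * (complex.Im (w x) * complex.Im (h x)) + complex.Re (w x) * complex.Re (h x).
  by apply/funext => x; case: (h x) (w x) => [a b] [a' b'] /=; ring.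
have imE : (fun x => complex.Im (w x * h x)) = fun x =>
    1 * (complex.Im (w x) * complex.Re (h x)) + complex.Re (w x) * complex.Im (h x).
  by apply/funext => x; case: (h x) (w x) => [a b] [a' b'] /=; ring.
split.
  by apply/in_L2_scalarP; rewrite reE imE; split; exact: sqint_lin.
rewrite /L2snorm -sqrtrM ?addr_ge0 ?sqr_ge0// ler_wsqrtr//.
(* The squared modulus is multiplicative: the mixed terms cancel and four squared products remain,
   bounded by [b1] to [b4]. *)
have -> : (fun x => complex.Re (w x * h x) ^+ 2 + complex.Im (w x * h x) ^+ 2) =
  fun x => ((complex.Re (w x) * complex.Re (h x)) ^+ 2 +
            (complex.Re (w x) * complex.Im (h x)) ^+ 2) +
           ((complex.Im (w x) * complex.Re (h x)) ^+ 2 +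
            (complex.Im (w x) * complex.Im (h x)) ^+ 2).
  by apply/funext => x; case: (h x) (w x) => [a b] [a' b'] /=; ring.
case: hr s1 s3 => [_ ihr] [_ i1] [_ i3]; case: hi s2 s4 => [_ ihi] [_ i2] [_ i4].
rewrite RintegralD//; [|exact: integrable_EFinD..].
by rewrite !RintegralD// mulrDr !mulrDl; lra.
Qed.

End complex_L2.

(** * L^2 fields with values in C^3 *)

Section vector_L2.
Variable R : realType.
Notation mu := (@leb3 R).
Implicit Types (A : set (pt R)) (v w z : cfield R) (c : R[i]).

(** The squared modulus of the field, kept real so that results on nonnegative integrands apply to
    [L2norm]. *)
Definition density v (x : pt R) : R :=
  \sum_i (complex.Re (v x i 0) ^+ 2 + complex.Im (v x i 0) ^+ 2).

Lemma density_ge0 v x : 0 <= density v x.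
Proof. by apply: sumr_ge0 => i _; rewrite addr_ge0 ?sqr_ge0. Qed.

Lemma L2normE A v : L2norm A v = Num.sqrt (\int[mu]_(x in A) density v x).
Proof.
rewrite /L2norm /ip /cint /=; congr (Num.sqrt _).
apply: eq_Rintegral => x _; rewrite /density.
rewrite (raddf_sum (@complex.Re R : Rcomplex R -> R)).
by apply: eq_bigr => i _; case: (v x i 0) => a b /=; ring.
Qed.

Lemma sqr_L2norm A v : L2norm A v ^+ 2 = \int[mu]_(x in A) density v x.
Proof.
rewrite L2normE sqr_sqrtr//; apply: Rintegral_ge0 => x _; exact: density_ge0.
Qed.

Lemma L2norm_ge0 A v : 0 <= L2norm A v.
Proof. exact: sqrtr_ge0. Qed.

Section on_set.
Variables (A : set (pt R)) (mA : measurable A).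

Lemma density_integrable v : in_L2 A v ->
  mu.-integrable A (fun x => (density v x)%:E).
Proof.
move=> L2v; rewrite (_ : (fun x => _) = (fun x => \sum_(i <- index_enum 'I_3)
   (complex.Re (v x i 0) ^+ 2 + complex.Im (v x i 0) ^+ 2)%:E)%E); last first.
  by apply/funext => x; rewrite /density sumEFin.
by apply: integrable_sum => // i _; case: (L2v i).
Qed.

Lemma L2snorm_le_L2norm v i : in_L2 A v ->
  L2snorm A (fun x => v x i 0) <= L2norm A v.
Proof.
move=> L2v; rewrite L2normE; apply/ler_wsqrtr/le_Rintegral => //.
- by case: (L2v i).
- exact: density_integrable.
- move=> x _; rewrite /density (bigD1 i)//= lerDl.
  by apply: sumr_ge0 => j _; rewrite addr_ge0 ?sqr_ge0.
Qed.

Lemma fieldE c v w x i : (c *: v + w) x i 0 = c * v x i 0 + w x i 0.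
Proof. by rewrite [LHS](_ : _ = (c *: v x + w x) i 0)// !mxE. Qed.

Lemma in_L2_lin c v w : in_L2 A v -> in_L2 A w -> in_L2 A (c *: v + w).
Proof.
move=> L2v L2w i; have := L2s_lin mA c (L2v i) (L2w i).
by congr in_L2_scalar; apply/funext => x; rewrite fieldE.
Qed.

Lemma ip_cintegrable v w : in_L2 A v -> in_L2 A w ->
  cintegrable A (fun x => \sum_i v x i 0 * (w x i 0)^*%C).
Proof.
move=> L2v L2w; apply: (cint_sum mA _ _).1 => i.
exact: (L2s_mulJ mA (L2v i) (L2w i)).1.
Qed.

Lemma ip_linl c v w z : in_L2 A v -> in_L2 A w -> in_L2 A z ->
  ip A (c *: v + w) z = c * ip A v z + ip A w z.
Proof.
move=> Lv Lw Lz; rewrite /ip -(cint_lin mA c _ _).2; [|exact: ip_cintegrable..].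
congr cint; apply/funext => x; rewrite mulr_sumr -big_split/=.
by apply: eq_bigr => i _; rewrite fieldE mulrDl mulrA.
Qed.

Lemma ip_linr c v w z : in_L2 A v -> in_L2 A w -> in_L2 A z ->
  ip A z (c *: v + w) = c^*%C * ip A z v + ip A z w.
Proof.
move=> Lv Lw Lz; rewrite /ip -(cint_lin mA _ _ _).2; [|exact: ip_cintegrable..].
congr cint; apply/funext => x; rewrite mulr_sumr -big_split/=.
by apply: eq_bigr => i _; rewrite fieldE rmorphD rmorphM mulrDr mulrCA.
Qed.

(** This serves both terms of the form, [kappa] directly and [mu] after embedding into complex
    matrices. The estimate is made entry by entry. *)
Lemma mx_Linfty (M : pt R -> 'M[R[i]]_3) :
  (forall i j, in_Linfty A (fun x => complex.Re (M x i j)) /\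
               in_Linfty A (fun x => complex.Im (M x i j))) ->
  (forall v, in_L2 A v -> in_L2 A (fun x => M x *m v x)) /\
  exists2 C, 0 <= C & forall v w, in_L2 A v -> in_L2 A w ->
    `|ip A (fun x => M x *m v x) w| <= (C * L2norm A v * L2norm A w)%:C%C.
Proof.
move=> LM; have {LM} /choice[C0 C0P] : forall ij : 'I_3 * 'I_3, exists C, 0 <= C /\
    forall h, in_L2_scalar A h -> in_L2_scalar A (fun x => M x ij.1 ij.2 * h x) /\
      L2snorm A (fun x => M x ij.1 ij.2 * h x) <= C * L2snorm A h.
  move=> [i j]; have [C C0 CP] := L2s_Linfty mA (LM i j).1 (LM i j).2.
  by exists C.
have LMs i j h : in_L2_scalar A h -> in_L2_scalar A (fun x => M x i j * h x).
  by case: (C0P (i, j)) => _ H /H[].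
split=> [v Lv i|].
  rewrite (_ : (fun x => _) = fun x => \sum_j M x i j * v x j 0).
    by apply: L2s_sum => // j; exact: LMs.
  by apply/funext => x; rewrite mxE.
(* [C0 (i, j)] bounds multiplication by the entry, and 4 is the factor of [L2s_mulJ]. *)
exists (\sum_i \sum_j 4 * C0 (i, j)).
  apply: sumr_ge0 => i _; apply: sumr_ge0 => j _; rewrite mulr_ge0//.
  by case: (C0P (i, j)).
move=> v w Lv Lw; pose F i j x := M x i j * v x j 0 * (w x i 0)^*%C.
have iF i j : cintegrable A (F i j).
  exact: (L2s_mulJ mA (LMs _ _ _ (Lv j)) (Lw i)).1.
have -> : ip A (fun x => M x *m v x) w = \sum_i \sum_j cint A (F i j).
  transitivity (cint A (fun x => \sum_i \sum_j F i j x)).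
    congr cint; apply/funext => x; apply: eq_bigr => i _.
    by rewrite mxE mulr_suml.
  rewrite (cint_sum mA _ _).2; last first.
    by move=> i; exact: (cint_sum mA _ (iF i)).1.
  by apply: eq_bigr => i _; rewrite (cint_sum mA _ _).2.
rewrite -mulrA mulr_suml rmorph_sum/=.
apply: le_trans (ler_norm_sum _ _ _) _; apply: ler_sum => i _.
rewrite mulr_suml rmorph_sum/=.
apply: le_trans (ler_norm_sum _ _ _) _; apply: ler_sum => j _.
have [C00 /(_ _ (Lv j))[LMv bMv]] := C0P (i, j).
apply: le_trans (L2s_mulJ mA LMv (Lw i)).2 _; rewrite lecR -!mulrA.
rewrite ler_pM2l// mulrA ler_pM ?sqrtr_ge0//; last exact: L2snorm_le_L2norm.
by apply: le_trans bMv _; rewrite ler_wpM2l//; exact: L2snorm_le_L2norm.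
Qed.

Lemma L2norm_ae_eq v w : in_L2 A v -> in_L2 A w -> ae_eq mu A v w ->
  L2norm A v = L2norm A w.
Proof.
move=> Lv Lw vw; rewrite !L2normE; congr (Num.sqrt (fine _)).
apply: ae_eq_integral => //.
- by case/integrableP : (density_integrable Lv).
- by case/integrableP : (density_integrable Lw).
- by apply: filterS vw => x /[apply] /= vw; rewrite /density vw.
Qed.

(** A nonnegative density with zero integral vanishes almost everywhere, and a vanishing sum of
    squares vanishes term by term. *)
Lemma L2norm_eq0 v : in_L2 A v -> L2norm A v = 0 -> ae_eq mu A v 0.
Proof.
move=> Lv v0; have id := density_integrable Lv.
have : (\int[mu]_(x in A) `|(density v x)%:E| = 0)%E.
  under eq_integral do rewrite gee0_abs ?lee_fin ?density_ge0//.
  have := sqr_L2norm A v; rewrite v0 expr0n /= /Rintegral => h.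
  by rewrite -[LHS]fineK ?integrable_fin_num// -h.
move/(ae_eq_integral_abs mu mA _).1; case/integrableP : id => md _ /(_ md).
apply: filterS => x /[apply] /= -[dx0]; apply/colP => i.
have nn (j : 'I_3) (_ : true) :
    0 <= complex.Re (v x j 0) ^+ 2 + complex.Im (v x j 0) ^+ 2.
  by rewrite addr_ge0 ?sqr_ge0.
have /eqP := psumr_eq0P nn dx0 (i := i) isT; rewrite mxE.
rewrite paddr_eq0 ?sqr_ge0// !sqrf_eq0 => /andP[/eqP r0 /eqP i0].
by apply/eqP; rewrite eq_complex r0 i0 !eqxx.
Qed.

End on_set.

Lemma L2norm_subset A B v : measurable A -> measurable B -> A `<=` B ->
  in_L2 B v -> L2norm A v <= L2norm B v.
Proof.
move=> mA mB AB Lv; rewrite !L2normE; apply/ler_wsqrtr/fine_le.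
- by apply/integrable_fin_num/(integrableS mB)/density_integrable.
- exact/integrable_fin_num/density_integrable.
apply: ge0_subset_integral => //.
- by case/integrableP : (density_integrable mB Lv).
- by move=> x _; rewrite lee_fin density_ge0.
Qed.

(** Each point of [A] lies in at least one [E k], so the density is at most the sum of its
    restrictions. Overlaps are allowed, whence an inequality. *)
Lemma L2norm_cover (I : finType) A (E : I -> set (pt R)) v :
  measurable A -> (forall k, measurable (E k)) -> A `<=` \bigcup_k E k ->
  in_L2 A v -> L2norm A v ^+ 2 <= \sum_k L2norm (E k `&` A) v ^+ 2.
Proof.
move=> mA mE AE Lv; have iv := density_integrable mA Lv.
have mv : measurable_fun A (fun x => (density v x)%:E) by case/integrableP : iv.
have mEA k : measurable (E k `&` A) by exact: measurableI.
have iE k : mu.-integrable (E k `&` A) (fun x => (density v x)%:E).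
  by apply: (integrableS mA).
under eq_bigr do rewrite sqr_L2norm.
rewrite sqr_L2norm -lee_fin -sumEFin fineK; last exact: integrable_fin_num.
under eq_bigr do rewrite fineK ?integrable_fin_num//.
(* All integrals are brought to the common domain [A], so that the sum can be moved inside. *)
under eq_bigr do rewrite integral_mkcondl.
rewrite -ge0_integral_sum//; last 2 first.
- move=> k; apply/measurable_restrict => //; exact: measurable_funS mv.
- by move=> k x _; apply: erestrict_ge0 => y _; rewrite lee_fin density_ge0.
apply: ge0_le_integral => //.
- by move=> x _; rewrite lee_fin density_ge0.
- apply: emeasurable_sum => k; apply/measurable_restrict => //.
  exact: measurable_funS mv.
move=> x /AE[k _ Ekx]; rewrite (bigD1 k)//= patchE mem_set// leeDl//.
by apply: sume_ge0 => j _; apply: erestrict_ge0 => y _; rewrite lee_fin density_ge0.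
Qed.

End vector_L2.

(** * The multiscale form, abstractly *)

(** Applied both to the coercivity of [B] and to the ellipticity of the multiscale form. *)
Lemma sqr_coercive_eq0 (R : rcfType) (c n : R) (b : R[i]) :
  0 < c -> (c * n ^+ 2)%:C%C <= `|b| -> b = 0 -> n = 0.
Proof.
move=> c0 + b0; rewrite b0 normr0 -[0]/(0%:C%C) lecR pmulr_rle0// => h.
by apply/eqP; rewrite -sqrf_eq0 eq_le h sqr_ge0.
Qed.

Section multiscale.
Variables (R : rcfType) (V : lmodType R[i]) (D : V -> Prop).
Variables (eqv : V -> V -> Prop) (nrm : V -> R) (B : V -> V -> R[i]).
Variables (pi K Kstar : V -> V) (alpha C Cpi : R).
Implicit Types (u v w z : V) (a : R[i]).

(** [D] stands for H_0(curl) on representatives and [eqv] for equality almost everywhere. The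
    discrete space appears as the elements fixed by [pi] up to [eqv]. *)
Let W w := D w /\ eqv (pi w) 0.

Hypothesis D0 : D 0.
Hypothesis D_lin : forall a v w, D v -> D w -> D (a *: v + w).
Hypothesis eqv_refl : forall v, eqv v v.
Hypothesis eqv_trans : forall v w z, eqv v w -> eqv w z -> eqv v z.
Hypothesis eqv_lin : forall a v v' w w',
  eqv v v' -> eqv w w' -> eqv (a *: v + w) (a *: v' + w').
Hypothesis nrm_ge0 : forall v, 0 <= nrm v.
Hypothesis nrm_eqv : forall v w, D v -> D w -> eqv v w -> nrm v = nrm w.
Hypothesis nrm_eq0 : forall v, D v -> nrm v = 0 -> eqv v 0.
Hypothesis B_linl : forall a v w z, D v -> D w -> D z ->
  B (a *: v + w) z = a * B v z + B w z.
Hypothesis B_linr : forall a v w z, D v -> D w -> D z ->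
  B z (a *: v + w) = a^*%C * B z v + B z w.
Hypothesis B_bounded : forall v w, D v -> D w ->
  `|B v w| <= (C * nrm v * nrm w)%:C%C.
Hypothesis alpha_gt0 : 0 < alpha.
Hypothesis B_coercive : forall v, D v ->
  (alpha * nrm v ^+ 2)%:C%C <= `|B v v|.
Hypothesis pi_D : forall v, D v -> D (pi v).
Hypothesis pi_lin : linear_op D eqv pi.
Hypothesis pi_idem : forall v, D v -> eqv (pi (pi v)) (pi v).
Hypothesis pi_bounded : forall v, D v -> nrm (pi v) <= Cpi * nrm v.
Hypothesis K_W : forall v, D v -> W (K v).
Hypothesis K_orth : forall v w, D v -> W w -> B (K v) w = - B v w.
Hypothesis Kstar_D : forall v, D v -> D (Kstar v).
Hypothesis Kstar_adj : forall v w, D v -> D w -> B (K v) w = B v (Kstar w).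

Let DD v w : D v -> D w -> D (v + w).
Proof. by move=> Dv Dw; rewrite -(scale1r v); exact: D_lin. Qed.

Let DB v w : D v -> D w -> D (v - w).
Proof. by move=> Dv Dw; rewrite addrC -scaleN1r; exact: D_lin. Qed.

Let BDl v w z : D v -> D w -> D z -> B (v + w) z = B v z + B w z.
Proof. by move=> Dv Dw Dz; rewrite -(scale1r v) B_linl// mul1r scale1r. Qed.

Let BBl v w z : D v -> D w -> D z -> B (v - w) z = B v z - B w z.
Proof.
by move=> Dv Dw Dz; rewrite addrC -scaleN1r B_linl// mulN1r addrC.
Qed.

Let BDr v w z : D v -> D w -> D z -> B z (v + w) = B z v + B z w.
Proof.
by move=> Dv Dw Dz; rewrite -(scale1r v) B_linr// rmorph1 mul1r scale1r.
Qed.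

Let BBr v w z : D v -> D w -> D z -> B z (v - w) = B z v - B z w.
Proof.
by move=> Dv Dw Dz; rewrite addrC -scaleN1r B_linr// rmorphN1 mulN1r addrC.
Qed.

Let KD v : D v -> D (K v). Proof. by move=> /K_W[]. Qed.

Let piD v w : D v -> D w -> eqv (pi (v + w)) (pi v + pi w).
Proof.
by move=> Dv Dw; have := pi_lin.2 1 _ _ Dv Dw; rewrite !scale1r.
Qed.

Let eqvB v v' w w' : eqv v v' -> eqv w w' -> eqv (v - w) (v' - w').
Proof.
by move=> vv' ww'; have := eqv_lin (-1) ww' vv'; rewrite !scaleN1r !(addrC (- _)).
Qed.

Let pi_sub v w : D v -> D w -> eqv (pi (v - w)) (pi v - pi w).
Proof.
move=> Dv Dw; have := pi_lin.2 (-1) _ _ Dw Dv.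
by rewrite !scaleN1r !(addrC (- _)).
Qed.

(* On [W], [- K] is the identity up to a null element. *)
Lemma corrector_kernel w z : W w -> D z -> B (w + K w) z = 0.
Proof.
move=> Ww Dz; have [Dw w0] := Ww; have [DKw Kw0] := K_W Dw.
have DwKw := DD Dw DKw.
have WwKw : W (w + K w).
  split=> //; apply: eqv_trans (piD Dw DKw) _.
  by have := eqv_lin 1 w0 Kw0; rewrite !scale1r addr0.
(* [w + K w] lies in [W] and is orthogonal to [W], hence to itself. *)
have n0 : nrm (w + K w) = 0.
  apply: (sqr_coercive_eq0 alpha_gt0 (B_coercive DwKw)).
  by rewrite BDl// K_orth// subrr.
apply/eqP; rewrite -normr_le0; apply: le_trans (B_bounded DwKw Dz) _.
by rewrite n0 mulr0 mul0r.
Qed.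

Lemma multiscale_formE v w : D v -> D w ->
  B (v + K v) (w + Kstar w) = B (v + K v) w.
Proof.
move=> Dv Dw; have DKv := KD Dv; have DKw := Kstar_D Dw.
rewrite BDr//; last exact: DD.
rewrite -Kstar_adj//; last exact: DD.
rewrite [X in _ + X]Kstar_adj//; last exact: DD.
(* [K] is additive only up to null elements, so the sum is split against [Kstar w] before moving [K]
   back. The result pairs [K v + K (K v)] with [w], where [K v] is in [W]. *)
rewrite [X in _ + X]BDl// -!Kstar_adj// -BDl//; last exact: KD.
by rewrite (corrector_kernel (K_W Dv) Dw) addr0.
Qed.

(** Once the corrector on the test side is dropped, the one on the trial side crosses over through
    the adjoint. *)
Lemma multiscale_test u v : D u -> D v ->
  B (u + K u) (v + Kstar v) = B u (v + Kstar v).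
Proof.
move=> Du Dv; have DKu := KD Du; have DKv := Kstar_D Dv.
by rewrite multiscale_formE// BDl// BDr// Kstar_adj.
Qed.

(* [K] is linear only up to null elements; the adjoint makes [B (K _) z]
   linear. *)
Let BKB v w z : D v -> D w -> D z ->
  B (v - w + K (v - w)) z = B (v + K v) z - B (w + K w) z.
Proof.
move=> Dv Dw Dz; have Dvw := DB Dv Dw; have DKz := Kstar_D Dz.
have DKv := KD Dv; have DKw := KD Dw; have DKvw := KD Dvw.
rewrite (BDl Dvw DKvw Dz) (BDl Dv DKv Dz) (BDl Dw DKw Dz) !Kstar_adj//.
by rewrite (BBl Dv Dw Dz) (BBl Dv Dw DKz) opprD addrACA.
Qed.

Lemma multiscale_elliptic : exists2 c : R, 0 < c &
  forall v, D v -> eqv (pi v) v ->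
    (c * nrm v ^+ 2)%:C%C <= `|B (v + K v) (v + Kstar v)|.
Proof.
(* [Cpi ^+ 2] comes from squaring [nv] below, and [+ 1] keeps the denominator positive. *)
exists (alpha / (Cpi ^+ 2 + 1)).
  by rewrite divr_gt0// ltr_wpDl ?sqr_ge0.
move=> v Dv piv; have DKv := KD Dv; have DvKv := DD Dv DKv.
have Bdiag : B (v + K v) (v + Kstar v) = B (v + K v) (v + K v).
  rewrite multiscale_formE// [RHS]BDr//.
  have -> : B (v + K v) (K v) = 0.
    by rewrite BDl// K_orth ?addrN//; exact: K_W.
  by rewrite addr0.
rewrite Bdiag; apply: le_trans (B_coercive DvKv); rewrite lecR.
have nv : nrm v <= Cpi * nrm (v + K v).
  apply: le_trans (pi_bounded DvKv); rewrite -(nrm_eqv (pi_D DvKv) Dv)//.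
  apply: eqv_trans (piD Dv DKv) _; have [_ Kv0] := K_W Dv.
  by have := eqv_lin 1 piv Kv0; rewrite !scale1r addr0.
rewrite -mulrA ler_pM2l// mulrC ler_pdivrMr ?ltr_wpDl ?sqr_ge0//.
apply: (@le_trans _ _ ((Cpi * nrm (v + K v)) ^+ 2)).
  by rewrite lerXn2r// nnegrE// (le_trans (nrm_ge0 v)).
by rewrite exprMn mulrC ler_wpM2l ?sqr_ge0// lerDl.
Qed.

Lemma multiscale_solution u v : D u -> D v ->
  B (pi u + K (pi u)) (v + Kstar v) = B u (v + Kstar v).
Proof.
move=> Du Dv; have Dpu := pi_D Du; rewrite -(multiscale_test Du Dv).
rewrite !multiscale_formE//.
have Ww : W (u - pi u).
  split; first exact: DB.
  apply: eqv_trans (pi_sub Du Dpu) _.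
  by have := eqvB (eqv_refl (pi u)) (pi_idem Du); rewrite subrr.
(* Split by [BKB], this says that [u] and [pi u] have the same corrected function as far as [B] can
   see. *)
have := corrector_kernel Ww Dv; have [Dw _] := Ww.
by rewrite BKB// => /eqP; rewrite subr_eq0 => /eqP ->.
Qed.

(** Boundedness reduces this to [nrm e = 0], that is [nrm 0 = 0], which coercivity yields from
    [B 0 0 = 0]. *)
Let B_eqv0 v e : D v -> D e -> eqv e 0 -> B v e = 0.
Proof.
move=> Dv De e0; apply/eqP; rewrite -normr_le0; apply: le_trans (B_bounded Dv De) _.
suff -> : nrm e = 0 by rewrite mulr0.
rewrite (nrm_eqv De D0 e0); apply: (sqr_coercive_eq0 alpha_gt0 (B_coercive D0)).
by rewrite -{1}(subrr 0) BBl// subrr.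
Qed.

(** Discrete test functions are represented as images [pi v]. The difference of [z] and [pi u] is
    discrete and its multiscale form with itself is zero. *)
Lemma multiscale_unique u z : D u -> D z -> eqv (pi z) z ->
  (forall v, D v ->
     B (z + K z) (pi v + Kstar (pi v)) = B u (pi v + Kstar (pi v))) ->
  eqv z (pi u).
Proof.
move=> Du Dz piz hz; have Dpu := pi_D Du; have [c c0 ell] := multiscale_elliptic.
have Dd : D (z - pi u) by exact: DB.
have pid : eqv (pi (z - pi u)) (z - pi u).
  by apply: eqv_trans (pi_sub Dz Dpu) _; apply: eqvB => //; exact: pi_idem.
set d := z - pi u in Dd pid *; have Dpd := pi_D Dd; have DdKd := DD Dd (KD Dd).
have d0 : eqv d 0.
  apply: nrm_eq0 => //; apply: (sqr_coercive_eq0 c0 (ell _ Dd pid)).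
  rewrite multiscale_formE//.
  (* Ellipticity pairs [d] with itself, while the equation is known against [pi d]; the two differ
     by a null element. *)
  have -> : B (d + K d) d = B (d + K d) (pi d).
    apply/esym/eqP; rewrite -subr_eq0 -BBr//; apply/eqP/B_eqv0 => //.
      exact: DB.
    by have := eqvB pid (eqv_refl d); rewrite subrr.
  rewrite BKB// -(multiscale_formE Dz Dpd) hz// -(multiscale_formE Dpu Dpd).
  by rewrite multiscale_solution// subrr.
have := eqv_lin 1 d0 (eqv_refl (pi u)).
by rewrite !scale1r subrK add0r.
Qed.

End multiscale.

(** * The space H_0(curl) and the form B *)

Section Hcurl_space.
Variables (R : realType) (Omega : set (pt R)).
Hypotheses (oO : open Omega) (bO : bounded_set Omega).
Implicit Types (v w z : hfield R) (c : R[i]) (phi : 'I_3 -> pt R -> R).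

Let mO : measurable Omega. Proof. exact: open_measurable_pt. Qed.

(** Turns the pairing with a real test field into an inner product, whose linearity is then
    available. *)
Definition complex_field phi : cfield R := fun x => \col_i (phi i x)%:C%C.

Lemma pair_testE (a : cfield R) phi :
  pair_test Omega a phi = ip Omega a (complex_field phi).
Proof.
congr cint; apply/funext => x; apply: eq_bigr => i _.
by rewrite mxE conjc_real.
Qed.

Lemma in_L2_continuous phi : (forall i, continuous (phi i)) ->
  in_L2 Omega (complex_field phi).
Proof.
move=> cphi i; have [C bC] := continuous_bounded_pt bO (cphi i).
have m := continuous_measurable_pt mO (cphi i).
have -> : (fun x => complex_field phi x i 0) = fun x => (phi i x)%:C%C.
  by apply/funext => x; rewrite mxE.
split=> //=.
apply: (@measurable_bounded_integrable _ _ _ _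
  (fun x => phi i x ^+ 2 + 0 ^+ 2)) => //.
- exact: bounded_leb3_lty.
- by apply: measurable_funD => //; exact: measurable_funX.
exists (C ^+ 2); split=> [|M CM x Ox /=]; first exact: num_real.
rewrite expr0n addr0 normrX.
apply/ltW/(le_lt_trans _ CM).
by rewrite lerXn2r// ?nnegrE ?(le_trans _ (bC _ Ox))// bC.
Qed.

Lemma test_field_continuous A phi : test_field A phi ->
  (forall i, continuous (phi i)) /\ (forall i, continuous (curl_test phi i)).
Proof.
move=> tphi; split=> i; first by have [/(_ 0%N)[]] := tphi i.
have cpartial j k : continuous (partial j (phi k)).
  by have [/(_ 1%N)[_ /(_ j)[_ []]]] := tphi k.
by move=> x; apply: cvgB; exact: cpartial.
Qed.

Lemma H0curl_in_L2 v : H0curl Omega v -> in_L2 Omega v.1 /\ in_L2 Omega v.2.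
Proof. by case=> -[]. Qed.

(** The weak curl and trace conditions are linear identities between pairings. Trace test fields
    need not vanish near the boundary; they are square integrable because [Omega] is bounded. *)
Lemma H0curl_lin c v w : H0curl Omega v -> H0curl Omega w ->
  H0curl Omega (c *: v + w).
Proof.
move=> Hv Hw; have [Lv1 Lv2] := H0curl_in_L2 Hv; have [Lw1 Lw2] := H0curl_in_L2 Hw.
have pair_lin (a b : cfield R) phi : in_L2 Omega a -> in_L2 Omega b ->
    (forall i, continuous (phi i)) -> pair_test Omega (c *: a + b) phi =
    c * pair_test Omega a phi + pair_test Omega b phi.
  move=> La Lb /in_L2_continuous Lphi.
  by rewrite !pair_testE; exact: ip_linl.
have [[_ _ cv] tv] := Hv; have [[_ _ cw] tw] := Hw.
split; first split.
- exact: in_L2_lin.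
- exact: in_L2_lin.
- move=> phi tphi; have [c1 c2] := test_field_continuous tphi.
  by rewrite [LHS]pair_lin// [RHS]pair_lin// cv// cw.
- move=> phi tphi; have [c1 c2] := test_field_continuous tphi.
  rewrite [X in X - _]pair_lin// [X in _ - X]pair_lin// opprD addrACA -mulrBr.
  by rewrite tv// tw// mulr0 addr0.
Qed.

Lemma H0curl0 : H0curl Omega 0.
Proof.
have p0 phi : pair_test Omega (0 : cfield R) phi = 0.
  rewrite -[RHS](cint0 Omega).2; congr cint; apply/funext => x.
  rewrite big1// => i _.
  by rewrite [X in X * _](_ : _ = (0 : 'cV_3) i 0)// mxE mul0r.
have L0 : in_L2 Omega (0 : cfield R).
  move=> i; have := L2s0 mO; congr in_L2_scalar; apply/funext => x.
  by rewrite [RHS](_ : _ = (0 : 'cV_3) i 0)// mxE.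
by split=> [|phi _]; [split=> // phi _|]; rewrite !p0 ?subr0.
Qed.

Lemma L2norm_le_Hcurl_norm v :
  L2norm Omega v.1 <= Hcurl_norm Omega v /\ L2norm Omega v.2 <= Hcurl_norm Omega v.
Proof.
rewrite /Hcurl_norm -[X in X <= _ /\ _]ger0_norm ?L2norm_ge0//.
rewrite -[X in _ /\ X <= _]ger0_norm ?L2norm_ge0// -!sqrtr_sqr.
by rewrite !ler_wsqrtr ?lerDl ?lerDr ?sqr_ge0.
Qed.

Lemma Hcurl_eq_lin c v v' w w' : Hcurl_eq Omega v v' -> Hcurl_eq Omega w w' ->
  Hcurl_eq Omega (c *: v + w) (c *: v' + w').
Proof.
have lin (a a' b b' : cfield R) : ae_eq (@leb3 R) Omega a a' ->
    ae_eq (@leb3 R) Omega b b' ->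
    ae_eq (@leb3 R) Omega (c *: a + b) (c *: a' + b').
  apply: filterS2 => x + + Ox => /(_ Ox) aa' /(_ Ox) bb'.
  by rewrite -[LHS]/(c *: a x + b x) aa' bb'.
by move=> [v1 v2] [w1 w2]; split; exact: lin.
Qed.

Lemma Hcurl_norm_eqv v w : H0curl Omega v -> H0curl Omega w ->
  Hcurl_eq Omega v w -> Hcurl_norm Omega v = Hcurl_norm Omega w.
Proof.
move=> /H0curl_in_L2[Lv1 Lv2] /H0curl_in_L2[Lw1 Lw2] [e1 e2].
by rewrite /Hcurl_norm (L2norm_ae_eq mO Lv1 Lw1 e1) (L2norm_ae_eq mO Lv2 Lw2 e2).
Qed.

Lemma Hcurl_norm_eq0 v : H0curl Omega v -> Hcurl_norm Omega v = 0 ->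
  Hcurl_eq Omega v 0.
Proof.
move=> /H0curl_in_L2[Lv1 Lv2] v0; have [n1 n2] := L2norm_le_Hcurl_norm v.
by rewrite v0 in n1 n2; split; apply: L2norm_eq0 => //; apply/eqP;
  rewrite eq_le L2norm_ge0 andbT.
Qed.

(** * Sesquilinearity and continuity of the form B *)

Section form.
Variables (mu : pt R -> 'M[R]_3) (kappa : pt R -> 'M[R[i]]_3).
Hypothesis coef : coefficients Omega mu kappa.
Let B := Bform Omega mu kappa.

Let muC x := map_mx (fun r : R => r%:C%C) (mu x).

Let muP := mx_Linfty mO (M := muC).
Let kappaP := mx_Linfty mO (M := kappa).

Let Linfty0 : in_Linfty Omega (fun=> 0 : R).
Proof. by split=> //; exists 0; apply: aeW => x _; rewrite normr0. Qed.

Let Lmu i j : in_Linfty Omega (fun x => complex.Re (muC x i j)) /\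
              in_Linfty Omega (fun x => complex.Im (muC x i j)).
Proof.
have [mu_ij _ _] := coef i j; split.
  by move: mu_ij; congr in_Linfty; apply/funext => x; rewrite mxE.
by move: Linfty0; congr in_Linfty; apply/funext => x; rewrite mxE.
Qed.

Let Lkappa i j : in_Linfty Omega (fun x => complex.Re (kappa x i j)) /\
                 in_Linfty Omega (fun x => complex.Im (kappa x i j)).
Proof. by have [] := coef i j. Qed.

Let mx_lin (M : pt R -> 'M[R[i]]_3) c (a b : cfield R) :
  (fun x => M x *m (c *: a + b) x) =
  c *: (fun x => M x *m a x) + (fun x => M x *m b x).
Proof.
apply/funext => x; rewrite -[RHS]/(c *: (M x *m a x) + M x *m b x).
by rewrite scalemxAr -mulmxDr.
Qed.

Lemma Bform_linl c v w z : H0curl Omega v -> H0curl Omega w -> H0curl Omega z ->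
  B (c *: v + w) z = c * B v z + B w z.
Proof.
move=> /H0curl_in_L2[Lv1 Lv2] /H0curl_in_L2[Lw1 Lw2] /H0curl_in_L2[Lz1 Lz2].
have [Lm _] := muP Lmu; have [Lk _] := kappaP Lkappa.
rewrite /B /Bform.
rewrite [X in ip _ X z.2](mx_lin muC c v.2 w.2).
rewrite [X in ip _ X z.1](mx_lin kappa c v.1 w.1).
rewrite !ip_linl//; [|exact: Lk..|exact: Lm|exact: Lm].
by rewrite mulrDr addrACA.
Qed.

Lemma Bform_linr c v w z : H0curl Omega v -> H0curl Omega w -> H0curl Omega z ->
  B z (c *: v + w) = c^*%C * B z v + B z w.
Proof.
move=> /H0curl_in_L2[Lv1 Lv2] /H0curl_in_L2[Lw1 Lw2] /H0curl_in_L2[Lz1 Lz2].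
have [Lm _] := muP Lmu; have [Lk _] := kappaP Lkappa.
rewrite /B /Bform [X in X + _](ip_linr mO c Lv2 Lw2 (Lm _ Lz2)).
by rewrite [X in _ + X](ip_linr mO c Lv1 Lw1 (Lk _ Lz1)) mulrDr addrACA.
Qed.

Lemma Bform_bounded : exists C, forall v w, H0curl Omega v -> H0curl Omega w ->
  `|B v w| <= (C * Hcurl_norm Omega v * Hcurl_norm Omega w)%:C%C.
Proof.
have [_ [C1 C10 b1]] := muP Lmu; have [_ [C2 C20 b2]] := kappaP Lkappa.
exists (C1 + C2) => v w /H0curl_in_L2[Lv1 Lv2] /H0curl_in_L2[Lw1 Lw2].
apply: le_trans (ler_normD _ _) _.
apply: le_trans (lerD (b1 _ _ Lv2 Lw2) (b2 _ _ Lv1 Lw1)) _.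
have [nv1 nv2] := L2norm_le_Hcurl_norm v; have [nw1 nw2] := L2norm_le_Hcurl_norm w.
rewrite -rmorphD/= lecR -!mulrA mulrDl.
by rewrite lerD// ler_wpM2l// ler_pM// L2norm_ge0.
Qed.

(** The defining property of the corrector Green's operator concerns bounded antilinear functionals,
    so this gives access to [Kop]. *)
Lemma Lop_dual v : H0curl Omega v -> H0curl_dual Omega (Lop Omega mu kappa v).
Proof.
move=> Hv; split=> [c w z Hw Hz|]; first exact: Bform_linr.
have [C BC] := Bform_bounded; exists (C * Hcurl_norm Omega v) => w Hw.
exact: BC.
Qed.

End form.

(** * Global boundedness of the Falk-Winther projection *)

Section FalkWinther_bound.
Variables (N : nat) (T : mesh R N) (Cpi : R) (piE : hfield R -> hfield R).
Hypotheses (partT : regular_partition Omega T) (FW : FalkWinther Omega T Cpi piE).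

(** Patch norms are at most norms over [Omega], and the local bounds are summed over the elements.
    The constant grows with [N], which suffices for ellipticity on a given mesh. *)
Lemma FalkWinther_bounded : exists C, forall v, H0curl Omega v ->
  Hcurl_norm Omega (piE v) <= C * Hcurl_norm Omega v.
Proof.
have [_ _ coverT] := partT; have [[_ piN _] bnd1 bnd2 _] := FW.
pose M := `|Cpi| * (1 + `|meshsize T|).
(* One [N] for the field and one for its curl; [M] covers both local estimates. *)
exists (Num.sqrt (N%:R + N%:R) * M) => v Hv; set n := Hcurl_norm Omega v.
have [Lv1 Lv2] := H0curl_in_L2 Hv; have [nv1 nv2] := L2norm_le_Hcurl_norm v.
have [Lp1 Lp2] := H0curl_in_L2 (piN _ Hv).1.
have n0 : 0 <= n by exact: sqrtr_ge0.
have M0 : 0 <= M by rewrite mulr_ge0// addr_ge0.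
have patchO k (w : cfield R) : in_L2 Omega w ->
    L2norm (Defs.patch T k `&` Omega) w <= L2norm Omega w.
  move=> Lw; apply: L2norm_subset => //.
  by apply: open_measurable_pt; apply: openI => //; exact: open_interior.
have local1 k : L2norm (elem T k `&` Omega) (piE v).1 <= M * n.
  apply: le_trans (bnd1 v k Hv) _; apply: le_trans (ler_norm _) _.
  rewrite normrM -mulrA ler_wpM2l//; apply: le_trans (ler_normD _ _) _.
  rewrite normrM !(ger0_norm (L2norm_ge0 _ _)) mulrDl mul1r lerD//.
    exact: le_trans (patchO k _ Lv1) nv1.
  by rewrite ler_wpM2l//; exact: le_trans (patchO k _ Lv2) nv2.
have local2 k : L2norm (elem T k `&` Omega) (piE v).2 <= M * n.
  apply: le_trans (bnd2 v k Hv) _; apply: le_trans (ler_norm _) _.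
  rewrite normrM -mulrA ler_wpM2l// (ger0_norm (L2norm_ge0 _ _)).
  rewrite mulrDl mul1r -[leLHS]addr0 lerD ?mulr_ge0//.
  exact: le_trans (patchO k _ Lv2) nv2.
have global (w : cfield R) : in_L2 Omega w ->
    (forall k, L2norm (elem T k `&` Omega) w <= M * n) ->
    L2norm Omega w ^+ 2 <= N%:R * (M * n) ^+ 2.
  move=> Lw lw.
  apply: (le_trans (@L2norm_cover _ _ _ (elem T) w mO _ _ Lw)) => [k||].
  - exact: conv_pts_measurable.
  - by rewrite coverT; exact: subset_closure.
  - rewrite mulr_natl -[X in _ *+ X]card_ord -sumr_const; apply: ler_sum => k _.
    by rewrite lerXn2r// nnegrE ?L2norm_ge0 ?mulr_ge0.
rewrite /Hcurl_norm -mulrA -[M * n]ger0_norm ?mulr_ge0// -sqrtr_sqr.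
rewrite -sqrtrM ?addr_ge0// ler_wsqrtr// mulrDl lerD//; exact: global.
Qed.

End FalkWinther_bound.
End Hcurl_space.

(** * The multiscale Galerkin problem on the Nedelec space *)

Theorem theorem5p5 (R : realType) (Omega : set (pt R))
  (mu : pt R -> 'M[R]_3) (kappa : pt R -> 'M[R[i]]_3) (alpha : R)
  (N : nat) (T : mesh R N) (gamma sigma Cpi : R)
  (piE : hfield R -> hfield R)
  (G : (hfield R -> R[i]) -> hfield R) (Kstar : hfield R -> hfield R)
  (f : cfield R) (u : hfield R) :
  let B := Bform Omega mu kappa in
  let K := Kop Omega mu kappa G in
  polyhedral_domain Omega ->
  coefficients Omega mu kappa ->
  0 < alpha ->
  (forall v, H0curl Omega v ->
     (alpha * Hcurl_norm Omega v ^+ 2)%:C%C <= `|B v v|) ->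
  regular_partition Omega T ->
  shape_regular T gamma ->
  quasi_uniform T sigma ->
  FalkWinther Omega T Cpi piE ->
  corrector_green Omega mu kappa piE G ->
  B_adjoint Omega mu kappa K Kstar ->
  Hdiv Omega f ->
  H0curl Omega u ->
  (forall psi, H0curl Omega psi -> B u psi = ip Omega f psi.1) ->
  [/\ Nedelec Omega T (piE u),
      galerkin Omega T mu kappa K Kstar f (piE u),
      forall z, Nedelec Omega T z -> galerkin Omega T mu kappa K Kstar f z ->
        Hcurl_eq Omega z (piE u) &
      exists2 c : R, 0 < c & forall vH, Nedelec Omega T vH ->
        (c * Hcurl_norm Omega vH ^+ 2)%:C%C <= `|B (vH + K vH) (vH + Kstar vH)|].
Proof.
move=> B K [oO bO _ _ _] coef alpha_gt0 Bcoer partT _ _ FW GW Kadj _ Hu uf.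
have mO : measurable Omega by exact: open_measurable_pt.
have [[piE_lin piN piN_id] _ _ _] := FW.
have pi_D v : H0curl Omega v -> H0curl Omega (piE v) by move=> /piN[].
have pi_idem v (Hv : H0curl Omega v) := piN_id _ (piN _ Hv).
have [Cp pi_bnd] := FalkWinther_bounded oO partT FW.
have [C B_bnd] := Bform_bounded oO coef.
have D0 := H0curl0 oO.
have D_lin := H0curl_lin oO bO.
have B_linl := Bform_linl oO coef; have B_linr := Bform_linr oO coef.
have eqv_refl (v : hfield R) : Hcurl_eq Omega v v.
  by split; exact: ae_eq_refl.
have eqv_trans (v w z : hfield R) :
    Hcurl_eq Omega v w -> Hcurl_eq Omega w z -> Hcurl_eq Omega v z.
  by move=> [e1 e2] [e3 e4]; split; [exact: ae_eq_trans e3|exact: ae_eq_trans e4].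
have eqv_lin c v v' w w' := @Hcurl_eq_lin R Omega c v v' w w'.
(* Linearity on representatives gives this only up to null fields, from [-1 *: 0 + 0 = 0]. *)
have pi_0 : Hcurl_eq Omega (piE 0) 0.
  have := piE_lin.2 (-1) 0 0 D0 D0; rewrite scaler0 addr0.
  by move=> h; apply: eqv_trans h _; rewrite scaleN1r addNr.
have DN v (Hv : H0curl Omega v) : H0curl Omega (- v).
  by have := D_lin (-1) v 0 Hv D0; rewrite scaleN1r addr0.
have GL v (Hv : H0curl Omega v) := GW _ (Lop_dual oO coef Hv).
have K_W v : H0curl Omega v -> Wker Omega piE (K v).
  move=> Hv; have [[HG piG] _] := GL v Hv; split; first exact: DN.
  have := piE_lin.2 (-1) _ 0 HG D0; rewrite scaleN1r addr0 => h.
  apply: eqv_trans h _.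
  by have := eqv_lin (-1) _ _ _ _ piG pi_0; rewrite scaler0 addr0.
have K_orth v w : H0curl Omega v -> Wker Omega piE w -> B (K v) w = - B v w.
  move=> Hv Ww; have [Hw _] := Ww; have [[HG _] orthG] := GL v Hv.
  have B0 : Bform Omega mu kappa 0 w = 0.
    by have := B_linl (-1) 0 0 w D0 D0 Hw; rewrite scaler0 addr0 mulN1r addNr.
  have := B_linl (-1) _ 0 w HG D0 Hw.
  by rewrite scaleN1r addr0 orthG// B0 addr0 mulN1r.
have [Kstar_D Kstar_adj] := Kadj.
have test_D v (Hv : H0curl Omega v) : H0curl Omega (v + Kstar v).
  by have := D_lin 1 v _ Hv (Kstar_D _ Hv); rewrite scale1r.
have nrm_ge0 (v : hfield R) : 0 <= Hcurl_norm Omega v by exact: sqrtr_ge0.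
have nrm_eqv := Hcurl_norm_eqv oO; have nrm_eq0 := Hcurl_norm_eq0 oO.
have solution := @multiscale_solution R _ (H0curl Omega) (Hcurl_eq Omega)
  (Hcurl_norm Omega) B piE K Kstar alpha C
  D_lin eqv_refl eqv_trans eqv_lin B_linl B_linr B_bnd alpha_gt0 Bcoer
  pi_D piE_lin pi_idem K_W K_orth Kstar_D Kstar_adj.
have unique := @multiscale_unique R _ (H0curl Omega) (Hcurl_eq Omega)
  (Hcurl_norm Omega) B piE K Kstar alpha C Cp
  D0 D_lin eqv_refl eqv_trans eqv_lin nrm_ge0 nrm_eqv nrm_eq0 B_linl B_linr
  B_bnd alpha_gt0 Bcoer
  pi_D piE_lin pi_idem pi_bnd K_W K_orth Kstar_D Kstar_adj.
have [c c0 ell] := @multiscale_elliptic R _ (H0curl Omega) (Hcurl_eq Omega)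
  (Hcurl_norm Omega) B piE K Kstar alpha C Cp
  D_lin eqv_trans eqv_lin nrm_ge0 nrm_eqv B_linl B_linr B_bnd alpha_gt0 Bcoer
  pi_D piE_lin pi_bnd K_W K_orth Kstar_D Kstar_adj.
split; first exact: piN.
(* [v + Kstar v] is admissible in the continuous problem, which turns the load into [B u]. *)
- move=> v [Hv _]; rewrite -uf; first exact: solution.
  exact: test_D.
- move=> z Nz gz; have [Hz _] := Nz.
  apply: unique Hu Hz (piN_id _ Nz) _ => v Hv; rewrite [RHS]uf.
    exact/gz/piN.
  by apply: test_D; exact: pi_D.
- by exists c => // v Nv; apply: ell; [case: Nv|exact: piN_id].
Qed.
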